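(* Suppose that $\nabla\nu\in [L^\infty(\bar{Q})]^d$ and that the time-step size is $\tau=T/N$ with $N\in\mathbb{N}$, $N\ge 2$. Suppose that $(\boldsymbol{u}_{n+1},p_{n+1})\in [H^1_0(\Omega)]^d\times L^2_0(\Omega)$, $n=0,\dots,N-1$, satisfy, starting from the initial velocity $\boldsymbol{u}_0$, the monolithic implicit-explicit generalised Laplacian scheme $$\frac{1}{\tau}(\boldsymbol{u}_{n+1}-\boldsymbol{u}_{n},\boldsymbol{w})+(\nu_{n}\nabla\boldsymbol{u}_{n+1},\nabla\boldsymbol{w}) +((\nabla\boldsymbol{u}_{n+1})\boldsymbol{u}_{n},\boldsymbol{w}) -(p_{n+1},\nabla\cdot\boldsymbol{w}) = (\nabla^{\top}\boldsymbol{u}_{n}\nabla\nu_n,\boldsymbol{w}) + (\boldsymbol{f}_{n+1},\boldsymbol{w}),$$ $$(q,\nabla\cdot\boldsymbol{u}_{n+1}) = 0,$$ for all $(\boldsymbol{w},q)\in [H^1_0(\Omega)]^d\times L^2_0(\Omega)$ and all $n=0,\dots,N-1$. Then, for every constant $\varepsilon>0$, $$\|\boldsymbol{u}_{N}\|^2 + \sum_{n=1}^{N}\tau\big\|\sqrt{\nu_{n-1}}\,\nabla\boldsymbol{u}_{n}\big\|^2 \leq M\Bigg[C_0 + \left(2\tau + \frac{T}{\varepsilon}\right)\sum_{n=1}^{N}\tau\|\boldsymbol{f}_n\|^2\Bigg],$$ where $$M =\exp\Big(\varepsilon + \frac{2T\|\nabla\nu \|_{\infty}^2}{\nu_{\mathrm{min}}}\Big),\qquad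 C_0 = \Big(1+\frac{\varepsilon\tau}{T}+\frac{2\|\nabla\nu \|^2_{\infty}\tau}{\nu_{\mathrm{min}}}\Big)\big(\|\boldsymbol{u}_0 \|^2 +\tau\nu_{\mathrm{min}}\|\nabla\boldsymbol{u}_0\|^2\big).$$
   Context: Setting: $\Omega\subset\mathbb{R}^d$, $d=2$ or $3$, is a bounded domain with Lipschitz boundary, $T>0$, and $Q=\Omega\times(0,T]$. The problem discretised in time is the incompressible Navier--Stokes system $\partial_t\boldsymbol{u}+(\nabla\boldsymbol{u})\boldsymbol{u}-\nabla\cdot[2\nu\nabla^{\mathrm{s}}\boldsymbol{u}]+\nabla p=\boldsymbol{f}$, $\nabla\cdot\boldsymbol{u}=0$ in $Q$, $\boldsymbol{u}=\boldsymbol{0}$ on $\partial\Omega\times(0,T]$, $\boldsymbol{u}=\boldsymbol{u}_0$ at $t=0$, where $\nabla^{\mathrm{s}}$ is the symmetric gradient. The viscosity $\nu=\nu(\boldsymbol{x},t)$ is given, with $\nu\ge\nu_{\mathrm{min}}>0$ in $\bar Q$ for a constant $\nu_{\mathrm{min}}$, and is such that all integrals in the scheme and the estimate are well defined and finite. The data satisfy $\boldsymbol{f}\in[L^2(Q)]^d$ and $\boldsymbol{u}_0\in[H^1_0(\Omega)]^d$ with $\nabla\cdot\boldsymbol{u}_0=0$. Notation: $t_n=n\tau$, $\nu_n=\nu(\cdot,t_n)$, $\boldsymbol{f}_n=\boldsymbol{f}(\cdot,t_n)\in[L^2(\Omega)]^d$. $\nabla\nu$ is the spatial gradient; $\|\cdot\|_\infty$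 is the $L^\infty(\bar Q)$ norm (of the Euclidean length, for vector fields), understood to bound the time-node values, i.e. $|\nabla\nu_n|\le\|\nabla\nu\|_\infty$ a.e. in $\Omega$ for every $n$. $(\cdot,\cdot)$ and $\|\cdot\|$ are the $L^2(\Omega)$ inner product and norm for scalar-, vector- and tensor-valued functions (Euclidean/Frobenius products pointwise). $L^2_0(\Omega)$ is the space of $L^2(\Omega)$ functions with zero mean. $(\nabla\boldsymbol{u})_{ij}=\partial_j u_i$, $\nabla^{\top}\boldsymbol{u}=(\nabla\boldsymbol{u})^{\top}$, so $(\nabla^{\top}\boldsymbol{u}\nabla\nu)_i=\sum_j\partial_i u_j\,\partial_j\nu$ and $((\nabla\boldsymbol{w})\boldsymbol{v})_i=\sum_j v_j\partial_j w_i$. *)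

(* Defs.v *)
From HB Require Import structures.
From mathcomp Require Import all_boot all_order all_algebra.
From mathcomp Require Import all_classical all_reals all_analysis.

Set Implicit Arguments.
Unset Strict Implicit.
Unset Printing Implicit Defensive.

Import Order.TTheory GRing.Theory Num.Theory.
Import numFieldNormedType.Exports.

Local Open Scope classical_set_scope.
Local Open Scope ring_scope.

(* The sigma-algebra is the one generated by the coordinates, as the library
   does for tuples; it is the Borel one. *)
Definition rV_display : measure_display.
Proof. exact: default_measure_display. Qed.

Section measurable_rV.
Context {R : realType} {n : nat}.

Definition rV_coord (i : 'I_n) (x : 'rV[R]_n) : measurableTypeR R := x ord0 i.

Let rV_set0 : g_sigma_preimage rV_coord set0.
Proof. exact: sigma_algebra0. Qed.

Let rV_setC A : g_sigma_preimage rV_coord A -> g_sigma_preimage rV_coord (~` A).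
Proof. exact: sigma_algebraC. Qed.

Let rV_bigcup (F : (set 'rV[R]_n)^nat) :
  (forall i, g_sigma_preimage rV_coord (F i)) ->
  g_sigma_preimage rV_coord (\bigcup_i (F i)).
Proof. exact: sigma_algebra_bigcup. Qed.

HB.instance Definition _ := @isMeasurable.Build rV_display
  'rV[R]_n (g_sigma_preimage rV_coord) rV_set0 rV_setC rV_bigcup.

Lemma measurable_rV_coord (i : 'I_n) : measurable_fun [set: 'rV[R]_n] (rV_coord i).
Proof.
move=> _ Y mY; rewrite setTI; apply: sub_sigma_algebra => /=.
rewrite -bigcup_seq/=; exists i => /=; first by rewrite mem_index_enum.
by exists Y => //; rewrite setTI.
Qed.

Lemma measurable_fun_rVP d (T : measurableType d) (f : T -> 'rV[R]_n) :
  (forall i, measurable_fun [set: T] (rV_coord i \o f)) ->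
  measurable_fun [set: T] f.
Proof.
move=> mf.
have prefS : g_sigma_preimage (fun i => rV_coord i \o f) `<=` measurable.
  apply: smallest_sub; first exact: sigma_algebra_measurable.
  rewrite -bigcup_seq; apply: bigcup_sub => i _ A [B mB <-]; exact: mf.
move=> _ A mA; apply: prefS; rewrite g_sigma_preimage_comp.
by exists A.
Qed.

End measurable_rV.

Section lebesgue_rV.
Context {R : realType}.

Definition rV_cons n (z : measurableTypeR R * 'rV[R]_n) : 'rV[R]_n.+1 :=
  \row_i oapp (z.2 ord0) z.1 (unlift ord0 i).

Definition rV_uncons n (x : 'rV[R]_n.+1) : measurableTypeR R * 'rV[R]_n :=
  (x ord0 ord0, \row_i x ord0 (lift ord0 i)).

Lemma rV_consK n : cancel (@rV_cons n) (@rV_uncons n).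
Proof.
move=> [t x]; rewrite /rV_uncons /rV_cons mxE unlift_none/=; congr (_, _).
by apply/rowP => i; rewrite !mxE liftK.
Qed.

Lemma rV_unconsK n : cancel (@rV_uncons n) (@rV_cons n).
Proof.
move=> x; apply/rowP => i; rewrite mxE.
by have [j|] := unliftP ord0 i => -> /=; rewrite ?mxE.
Qed.

Lemma measurable_rV_cons n : measurable_fun setT (@rV_cons n).
Proof.
apply: measurable_fun_rVP => i.
have [j|] := unliftP ord0 i => ->.
  rewrite (_ : _ \o _ = rV_coord j \o snd); last first.
    by apply/funext => z /=; rewrite /rV_coord mxE liftK.
  by apply: measurableT_comp => //; exact: measurable_rV_coord.
rewrite (_ : _ \o _ = fst)//.
by apply/funext => z /=; rewrite /rV_coord mxE unlift_none.
Qed.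

Lemma measurable_rV_uncons n : measurable_fun setT (@rV_uncons n).
Proof.
apply: measurable_fun_pair; first exact: (measurable_rV_coord ord0).
apply: measurable_fun_rVP => i.
rewrite (_ : _ \o _ = rV_coord (lift ord0 i)); last first.
  by apply/funext => x /=; rewrite /rV_coord mxE.
exact: measurable_rV_coord.
Qed.

Section step.
Variables (n : nat) (m : {sigma_finite_measure set 'rV[R]_n -> \bar R}).

Definition leb_step : set 'rV[R]_n.+1 -> \bar R :=
  pushforward (lebesgue_measure \x m)%E (@rV_cons n).

Let preimage_rV_cons A :
  measurable A -> measurable (@rV_cons n @^-1` A).
Proof.
by move=> mA; rewrite -[X in measurable X]setTI; exact: measurable_rV_cons.
Qed.

Let leb_step0 : leb_step set0 = 0%E.
Proof. by rewrite /leb_step /pushforward preimage_set0 measure0. Qed.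

Let leb_step_ge0 A : (0 <= leb_step A)%E.
Proof. exact: (measure_ge0 (lebesgue_measure \x m)%E). Qed.

Let leb_step_sigma_additive : semi_sigma_additive leb_step.
Proof.
move=> F mF tF mUF; rewrite /leb_step /pushforward preimage_bigcup.
apply: measure_semi_sigma_additive.
- by move=> k; exact: preimage_rV_cons.
- apply/trivIsetP => /= i j _ _ ij; rewrite -preimage_setI.
  by move/trivIsetP : tF => /(_ _ _ _ _ ij) ->//; rewrite preimage_set0.
- by rewrite -preimage_bigcup; exact: preimage_rV_cons.
Qed.

HB.instance Definition _ := isMeasure.Build _ _ _ leb_step
  leb_step0 leb_step_ge0 leb_step_sigma_additive.

Let leb_step_sigma_finite : sigma_finite setT leb_step.
Proof.
have /sigma_finiteP[F [TF ndF Foo]] :=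
  @sigma_finiteT _ _ _ (@lebesgue_measure R).
have /sigma_finiteP[G [TG ndG Goo]] := sigma_finiteT m.
exists (fun k => @rV_uncons n @^-1` (F k `*` G k)).
  apply/esym; rewrite -subTset => x _.
  have [i _ Fi] : (\bigcup_k F k) (rV_uncons x).1 by rewrite -TF.
  have [j _ Gj] : (\bigcup_k G k) (rV_uncons x).2 by rewrite -TG.
  exists (maxn i j) => //; split.
  - by apply: subsetPset (ndF _ _ (leq_maxl i j)) _ Fi.
  - by apply: subsetPset (ndG _ _ (leq_maxr i j)) _ Gj.
move=> k; have [mF Fk] := Foo k; have [mG Gk] := Goo k; split.
  rewrite -[X in measurable X]setTI; apply: measurable_rV_uncons => //.
  exact: measurableX.
rewrite /leb_step /pushforward -comp_preimage.
rewrite (_ : _ \o _ = id); last by apply/funext => z; exact: rV_consK.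
by rewrite product_measure1E// lte_mul_pinfty// ge0_fin_numE.
Qed.

HB.instance Definition _ :=
  Measure_isSigmaFinite.Build _ _ _ leb_step leb_step_sigma_finite.

End step.

(* The n-fold product of the one-dimensional Lebesgue measure. *)
Fixpoint leb n : {sigma_finite_measure set 'rV[R]_n -> \bar R} :=
  match n with
  | 0 => \d_ (0 : 'rV[R]_0)
  | n.+1 => leb_step (leb n)
  end.

End lebesgue_rV.

Notation vol := (leb _).

(* Points and vector fields are row vectors, so a matrix [A] acts on a vector
   [v] by [v *m A^T]. *)

Section euclid.
Context {R : realType}.

Definition dotmx m n (A B : 'M[R]_(m, n)) : R := \sum_i \sum_j A i j * B i j.

Definition enorm m n (A : 'M[R]_(m, n)) : R := Num.sqrt (dotmx A A).

(* Near each boundary point, and up to an orthogonal change [O] of coordinates,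
   [U] lies strictly above the graph of a Lipschitz function [g] of the
   coordinates other than the [k]-th one. *)
Definition lipschitz_boundary n (U : set 'rV[R]_n) : Prop :=
  forall x, closure U x -> ~ interior U x ->
  exists (r : R) (O : 'M[R]_n) (k : 'I_n) (L : R) (g : 'rV[R]_n.-1 -> R),
    [/\ 0 < r, O *m O^T = 1%:M,
        (forall y z, `|g y - g z| <= L * enorm (y - z)) &
        forall y, enorm (y - x) < r ->
          (U y <-> g (col' k (y *m O)) < (y *m O) ord0 k)].

Definition bounded_lipschitz_domain n (U : set 'rV[R]_n) : Prop :=
  [/\ U !=set0, open U, connected U, bounded_set U & lipschitz_boundary U].

End euclid.

(* Functions are defined on the whole of ['rV[R]_n], but only their values on
   the open set [U] matter. *)

Section sobolev.
Context {R : realType} {n : nat}.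
Implicit Types (U : set 'rV[R]_n) (f g q : 'rV[R]_n -> R) (i : 'I_n).

Definition pderiv i f : 'rV[R]_n -> R := fun x => 'D_(delta_mx ord0 i) f x.

Definition smooth f : Prop :=
  forall s : seq 'I_n, let g := foldr pderiv f s in
    continuous g /\ forall i x, derivable g x (delta_mx ord0 i).

(* An element of C_c^\infty(U), extended by 0. *)
Definition test_function U f : Prop :=
  let K := closure [set x | f x != 0] in [/\ smooth f, compact K & K `<=` U].

Definition L1loc U f : Prop :=
  measurable_fun U f /\
  forall K, compact K -> K `<=` U -> vol.-integrable K (EFin \o f).

Definition is_weak_pderiv U i f g : Prop :=
  [/\ L1loc U f, L1loc U g &
      forall phi, test_function U phi ->
        \int[vol]_(x in U) (f x * pderiv i phi x) =
        - \int[vol]_(x in U) (g x * phi x)].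

Definition weakly_derivable U i f : Prop := exists g, is_weak_pderiv U i f g.

(* A representative of the weak derivative, junk if there is none. *)
Definition weak_pderiv U i f : 'rV[R]_n -> R := get (is_weak_pderiv U i f).

Definition L2 U f : Prop :=
  measurable_fun U f /\ vol.-integrable U (fun x => (f x ^+ 2)%:E).

Definition L20 U q : Prop := L2 U q /\ \int[vol]_(x in U) q x = 0.

Definition H1 U f : Prop :=
  L2 U f /\ forall i, weakly_derivable U i f /\ L2 U (weak_pderiv U i f).

(* The closure of C_c^\infty(U) in H^1(U); the weak derivative of a test
   function is its classical one. *)
Definition H10 U f : Prop :=
  H1 U f /\
  forall e : R, 0 < e -> exists2 phi, test_function U phi &
    \int[vol]_(x in U) ((f x - phi x) ^+ 2) +
    \sum_i \int[vol]_(x in U) ((weak_pderiv U i f x - pderiv i phi x) ^+ 2)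
      < e ^+ 2.

Definition ip U p r (F G : 'rV[R]_n -> 'M[R]_(p, r)) : R :=
  \int[vol]_(x in U) dotmx (F x) (G x).

Definition L2norm U p r (F : 'rV[R]_n -> 'M[R]_(p, r)) : R :=
  Num.sqrt (ip U F F).

Definition grad U f : 'rV[R]_n -> 'rV[R]_n :=
  fun x => \row_j weak_pderiv U j f x.

End sobolev.

Section vector_fields.
Context {R : realType} {n : nat}.
Implicit Types (U : set 'rV[R]_n) (v w : 'rV[R]_n -> 'rV[R]_n).

Definition component p (w : 'rV[R]_n -> 'rV[R]_p) (i : 'I_p) : 'rV[R]_n -> R :=
  fun x => w x ord0 i.

Definition L2_vec U p (w : 'rV[R]_n -> 'rV[R]_p) : Prop :=
  forall i, L2 U (component w i).

Definition H10_vec U w : Prop := forall i, H10 U (component w i).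

(* [vgrad U w x i j] is [\partial_j w_i] at [x] *)
Definition vgrad U w : 'rV[R]_n -> 'M[R]_n :=
  fun x => \matrix_(i, j) weak_pderiv U j (component w i) x.

Definition divergence U w : 'rV[R]_n -> R := fun x => \tr (vgrad U w x).

End vector_fields.

(* A function of [(x, t)] is seen as a function on ['rV_(n + 1)] whose last
   coordinate is the time. *)

Section space_time.
Context {R : realType} {n : nat}.

Definition uncurry_st (S : Type) (h : 'rV[R]_n -> R -> S) :
    'rV[R]_(n + 1) -> S :=
  fun z => h (lsubmx z) (rsubmx z ord0 ord0).

Definition cylinder (U : set 'rV[R]_n) (I : set R) : set 'rV[R]_(n + 1) :=
  [set z | U (lsubmx z) /\ I (rsubmx z ord0 ord0)].

(* The weak spatial gradient of [h] on the interior U x (0, T) of the space-time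
   cylinder *)
Definition st_grad (U : set 'rV[R]_n) (T : R) (h : 'rV[R]_n -> R -> R) :
    'rV[R]_(n + 1) -> 'rV[R]_n :=
  fun z => \row_j
    weak_pderiv (cylinder U `]0, T[) (lshift 1 j) (uncurry_st h) z.

(* The L^\infty norm over U x (0, T); for a Lipschitz domain this is the norm
   over the closed cylinder, whose boundary is a null set. *)
Definition Linf_norm (U : set 'rV[R]_n) (T : R)
    (F : 'rV[R]_(n + 1) -> 'rV[R]_n) : \bar R :=
  Lnorm vol +oo%E ((EFin \o (fun z => enorm (F z))) \_ (cylinder U `]0, T[)).

Definition Linf_grad (U : set 'rV[R]_n) (T : R) (h : 'rV[R]_n -> R -> R) :
    Prop :=
  (forall j : 'I_n, weakly_derivable (cylinder U `]0, T[) (lshift 1 j)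
                      (uncurry_st h)) /\
  (Linf_norm U T (st_grad U T h) < +oo)%E.

End space_time.

(* Main.v *)
From HB Require Import structures.
From mathcomp Require Import all_boot all_order all_algebra.
From mathcomp Require Import all_classical all_reals all_analysis measurable_realfun.
From mathcomp Require Import ring lra.
Require Import Defs.

Set Implicit Arguments.
Unset Strict Implicit.
Unset Printing Implicit Defensive.

Import Order.TTheory GRing.Theory Num.Theory.
Import numFieldNormedType.Exports.

Local Open Scope classical_set_scope.
Local Open Scope ring_scope.

(** Test the scheme with [u_{n+1}]. The pressure term vanishes, and so does the
    convective one. For the latter no Sobolev embedding is needed: with
    [G_k(w) = 1 - 1 / (1 + k |w|^2)], whose gradient is bounded and Lipschitz,
    [int v . grad (G_k o w) = 0] follows from [div v = 0] by density of test
    functions, and dominated convergence as [k -> 0] gives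
    [int (v . grad w) . w = 0] whenever that integrand is integrable.

    Writing [u_{n+1} = u_n + d] in the two terms on the right and absorbing the
    parts in [d] into the [|d|^2 / tau] of the discrete time derivative yields
    [a_{n+1} + 2 tau D_{n+1} <= (1 + gam) (a_n + tau D_n) + F_{n+1}] with
    [a_n = |u_n|^2], [D_n = |sqrt(nu_{n-1}) grad u_n|^2] and
    [gam = eps tau / T + 2 K^2 tau / nu_min], hence the estimate by a discrete
    Gronwall argument, with no restriction on the size of [tau]. *)

(** The convective integrand is cubic, so the $H^1$ norm controls it only through a Sobolev
    embedding, while [H10] offers approximation in that norm alone. Damping makes it a product of
    two $L^2$ functions. Even then, replacing [w] by test functions pairs the merely integrable
    [v dw] with a difference of damped values that is small only in $L^2$. Hence a truncation
    height, with limits in this order: test functions, height, damping.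

    In the energy part, Young's inequality against [u_{n+1}] would put $|u_{n+1}|^2$ on the right,
    and absorbing it would force $\tau$ to be small. Pairing with [u_n] avoids this; the remainders
    in [d] cost one half of $|d|^2$ for the viscosity gradient and one half for the forcing, exactly
    what the time difference supplies. The explicit term also needs $|\nabla u_n|^2$, which is paid
    by one of the two copies of $\tau D_n$ left over from the preceding step; the other copy builds
    up the sum in the estimate. At $n=0$ there is no preceding step, and $\nu_{min}|\nabla u_0|^2$
    takes the place of $D_0$. *)

(** * Measurability of open sets and finite volume of bounded sets in ['rV[R]_n] *)

Section rV_borel.
Context {R : realType}.

Lemma measurable_rV_preimage n (i : 'I_n) (B : set (measurableTypeR R)) :
  measurable B -> measurable [set x : 'rV[R]_n | B (x ord0 i)].
Proof.
move=> mB; rewrite -[X in measurable X]setTI.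
exact: (@measurable_rV_coord R n i).
Qed.

Lemma measurable_rV_box n (A : 'I_n -> set (measurableTypeR R)) :
  (forall i, measurable (A i)) ->
  measurable [set x : 'rV[R]_n | forall i, A i (x ord0 i)].
Proof.
move=> mA.
rewrite (_ : [set x | _] =
    \big[setI/setT]_(i < n) [set x : 'rV[R]_n | A i (x ord0 i)]).
  by apply: bigsetI_measurable => i _; exact: measurable_rV_preimage.
rewrite -bigcap_seq; apply/seteqP; split => x /=.
  by move=> Ax i _; exact: Ax.
by move=> Ax i; apply: Ax => /=; rewrite mem_index_enum.
Qed.

(** The sigma-algebra is generated by coordinates and the topology by sup-norm balls, so an open set
    is a countable union of boxes with rational centre and radius. A radius below [e / 2] works: a
    rational point within it of [x] has its box inside the ball of radius [e]. *)
Lemma open_rV_measurable n (U : set 'rV[R]_n) : open U -> measurable U.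
Proof.
move=> oU.
pose box (q : 'rV[rat]_n) (e : rat) :=
  [set x : 'rV[R]_n | forall i, ball (ratr (q ord0 i) : R) (ratr e) (x ord0 i)].
have -> : U = \bigcup_(qe in [set qe : 'rV[rat]_n * rat | box qe.1 qe.2 `<=` U])
    box qe.1 qe.2.
  apply/seteqP; split => [x Ux|x [qe /= + boxx]]; last exact.
  have : nbhs x U by apply: open_nbhs_nbhs.
  move=> /nbhs_ballP [e /= e0 eU].
  have [r] := rat_in_itvoo (divr_gt0 e0 (ltr0Sn R 1)).
  rewrite in_itv/= => /andP[r0 re].
  have hq (i : 'I_n) : exists q : rat, ball (x ord0 i) (ratr r : R) (ratr q).
    have [q] := rat_in_itvoo (ltr_pwDr r0 (lexx (x ord0 i))).
    rewrite in_itv/= => /andP[xq qx]; exists q.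
    by rewrite /ball/= distrC gtr0_norm ?subr_gt0// ltrBlDl.
  have [q hq'] := choice hq.
  exists (\row_i q i, r) => /=; last by move=> i; rewrite mxE; apply/ball_sym.
  move=> y ry; apply: eU; split=> // i j; rewrite (ord1 i).
  have := ry j; rewrite mxE => rj.
  apply: le_ball (ball_triangle (hq' j) rj).
  by move: re; lra.
rewrite bigcup_mkcond; apply: countable_bigcupT_measurable => [|qe].
  exact: countableP.
case: ifP => // _; apply: (@measurable_rV_box n
  (fun i => ball (ratr (qe.1 ord0 i) : R) (ratr qe.2))) => i.
rewrite ball_itv; exact: measurable_itv.
Qed.

Lemma continuous_rV_measurable_fun n (f : 'rV[R]_n -> R) (D : set 'rV[R]_n) :
  continuous f -> measurable_fun D f.
Proof.
move=> cf; apply: measurable_funTS.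
apply: (measurability _ (RGenOpens.measurableE R)) => _ [_ [a [b ->]] <-].
rewrite setTI; apply: open_rV_measurable.
by move/continuousP : cf; apply; exact: interval_open.
Qed.

Definition rV_box n (r : R) : set 'rV[R]_n := [set x | forall i, `|x ord0 i| <= r].

Lemma measurable_box n (r : R) : measurable (@rV_box n r).
Proof.
apply: (@measurable_rV_box n (fun=> [set t | `|t| <= r])) => i.
rewrite (_ : [set t | _] = `[- r, r]%classic); first exact: measurable_itv.
by apply/seteqP; split => t /=; rewrite in_itv/= ler_norml.
Qed.

Lemma vol_box_lty n (r : R) :
  (vol (@rV_box n r) < +oo)%E.
Proof.
elim: n => [|n IHn]; first by rewrite /= diracE; case: (_ \in _); rewrite ltry.
have -> : leb n.+1 (@rV_box n.+1 r) =
  (lebesgue_measure \x leb n)%E (@rV_cons R n @^-1` (@rV_box n.+1 r)) by [].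
rewrite (_ : _ @^-1` _ = `[- r, r]%classic `*` @rV_box n r).
  rewrite product_measure1E//.
    rewrite lte_mul_pinfty//= lebesgue_measure_itv/=.
    by case: ifP => // _; rewrite ltry.
  exact: measurable_box.
apply/seteqP; split=> [[t x] /= h|[t x] /= [+ h] i].
  split; first by have := h ord0; rewrite mxE unlift_none/= in_itv/= ler_norml.
  by move=> i; have := h (lift ord0 i); rewrite mxE liftK.
rewrite in_itv/= -ler_norml => tr; rewrite mxE.
by case: unliftP => [j|] _ //=.
Qed.

Lemma rV_norm_coord n (x : 'rV[R]_n) i : `|x ord0 i| <= `|x|.
Proof.
rewrite [leRHS]/Num.Def.normr /= mx_normrE; apply/bigmax_geP; right => /=.
by exists (ord0, i).
Qed.

Lemma bounded_rV_box n (U : set 'rV[R]_n) : bounded_set U ->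
  exists2 r : R, 0 < r & U `<=` @rV_box n r.
Proof.
move=> [M [Mreal UM]]; exists (`|M| + 1); first by rewrite ltr_wpDl.
move=> x Ux i; apply: le_trans (rV_norm_coord x i) _; apply: UM => //.
by rewrite (le_lt_trans (ler_norm _))// ltrDl.
Qed.

Lemma bounded_vol_lty n (U : set 'rV[R]_n) :
  measurable U -> bounded_set U -> (vol U < +oo)%E.
Proof.
move=> mU /bounded_rV_box[r r0 Ur]; apply: le_lt_trans (vol_box_lty n r).
apply: le_measure => //; rewrite inE//.
exact: measurable_box.
Qed.

End rV_borel.

(** * Integrals of partial derivatives of compactly supported functions *)

Section vanishing_outside_box.
Context {R : realType}.

Lemma compact_box n (r : R) : compact (@rV_box R n r).
Proof.
apply: (@rV_compact _ n (fun=> [set t : R | `|t| <= r])) => i.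
rewrite (_ : [set t | _] = `[- r, r]%classic); first exact: segment_compact.
by apply/seteqP; split => t /=; rewrite in_itv/= ler_norml.
Qed.

Lemma closed_box n (r : R) : closed (@rV_box R n r).
Proof. by apply: compact_closed; [exact: norm_hausdorff|exact: compact_box]. Qed.

Lemma continuous_bounded_on_compact n (g : 'rV[R]_n -> R) (A : set 'rV[R]_n) :
  continuous g -> compact A -> exists2 M : R, 0 < M & forall x, A x -> `|g x| <= M.
Proof.
move=> cg cA.
have /compact_bounded[M [_ Mg]] : compact (g @` A).
  by apply: continuous_compact => //; exact: continuous_subspaceT.
exists (`|M| + 1); first by rewrite ltr_wpDl.
move=> x Ax; apply: Mg; last by exists x.
by rewrite (le_lt_trans (ler_norm _))// ltrDl.
Qed.

Lemma integrable_vanishing_outside_box n (g : 'rV[R]_n -> R) (r : R) :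
  continuous g -> (forall x, ~ rV_box r x -> g x = 0) ->
  vol.-integrable setT (EFin \o g).
Proof.
move=> cg g0.
have -> : EFin \o g = (EFin \o g) \_ (rV_box r).
  apply/funext => x; rewrite patchE; case: ifPn => //.
  by rewrite notin_setE => /g0 /= ->.
apply/(integrable_mkcond _ (measurable_box r)).
apply: measurable_bounded_integrable.
- exact: measurable_box.
- exact: vol_box_lty.
- exact: continuous_rV_measurable_fun.
- have [M M0 gM] := continuous_bounded_on_compact cg (@compact_box n r).
  by exists M; split=> [|z Mz x /gM /le_trans]; [exact: num_real|apply; exact: ltW].
Qed.

(** A point off the closed set [A] has a whole neighbourhood off [A], on which [f] is the zero
    function. *)
Lemma derive_vanishing (V : normedModType R) (f : V -> R) (A : set V) v x :
  closed A -> (forall x, ~ A x -> f x = 0) -> ~ A x -> 'D_v f x = 0.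
Proof.
move=> cA f0 Ax; have [->|v0] := eqVneq v 0.
  exact: derive0.
rewrite (@near_eq_derive _ _ _ f (cst 0))//; first exact: derive_cst.
have : nbhs x (~` A) by apply: open_nbhs_nbhs; split=> //; exact: closed_openC.
by apply: filterS => y /f0 ->.
Qed.

Lemma integral_derive1_vanishing (h : R -> R) (r : R) :
  (forall t, derivable h t 1) -> continuous (derive1 h) ->
  (forall t, ~ (`|t| <= r) -> h t = 0) ->
  (\int[lebesgue_measure]_t (derive1 h t)%:E = 0)%E.
Proof.
move=> dh ch h0.
(* A bound that is positive even for negative [r], and strictly beyond [r], so that [h] vanishes at
   both end points. *)
pose b := `|r| + 1.
have b0 : 0 < b by rewrite /b; exact: ltr_wpDl.
have hb t : b <= `|t| -> h t = 0.
  move=> bt; apply: h0 => tr; have := le_trans bt tr; rewrite leNgt.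
  by rewrite (le_lt_trans (ler_norm _))// ltrDl.
have -> : (fun t => (derive1 h t)%:E) = (fun t => (derive1 h t)%:E) \_ `[- b, b].
  apply/funext => t; rewrite patchE; case: ifPn => //.
  rewrite notin_setE/= in_itv/= -ler_norml => tb; congr EFin.
  rewrite derive1E; apply: (@derive_vanishing _ _ `[- b, b]) => //.
  - exact: interval_closed.
  - move=> z/=; rewrite in_itv/= -ler_norml => zb; apply: hb.
    by rewrite leNgt; apply/negP => /ltW.
  - by rewrite /= in_itv/= -ler_norml.
rewrite -integral_mkcond.
have ch' : continuous h.
  by move=> t; apply/differentiable_continuous/derivable1_diffP.
rewrite (@continuous_FTC2 _ _ h).
- by rewrite !hb ?normrN ?gtr0_norm// subee.
- by rewrite -subr_gt0 opprK addr_gt0.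
- exact: continuous_subspaceT.
- split.
  + by move=> t _; exact: dh.
  + by apply: cvg_at_right_filter; exact: ch'.
  + by apply: cvg_at_left_filter; exact: ch'.
- by [].
Qed.

Lemma continuous_rV_cons_r n (t : R) :
  continuous (fun x : 'rV[R]_n => rV_cons (t, x)).
Proof.
move=> x A /= /(nbhs_ballP (rV_cons (t, x))) [e e0 eA].
apply/nbhs_ballP; exists e => // y [_ xy]; apply: eA; split=> // a j; rewrite !mxE.
by case: unliftP => [k|] _ /=; [exact: xy|exact: ballxx].
Qed.

Lemma continuous_rV_cons_l n (x : 'rV[R]_n) :
  continuous (fun t : R => rV_cons (t, x)).
Proof.
move=> t A /= /(nbhs_ballP (rV_cons (t, x))) [e e0 eA].
apply/nbhs_ballP; exists e => // s ts; apply: eA; split=> // a j; rewrite !mxE.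
by case: unliftP => [k|] _ //=; exact: ballxx.
Qed.

Lemma integrable_rV_cons n (g : 'rV[R]_n.+1 -> R) :
  measurable_fun setT g -> vol.-integrable setT (EFin \o g) ->
  (lebesgue_measure \x leb n)%E.-integrable setT (fun z => (g (rV_cons z))%:E).
Proof.
move=> mg /integrableP[_ ig]; apply/integrableP; split.
  apply/measurable_EFinP; apply: measurableT_comp => //.
  exact: measurable_rV_cons.
apply: le_lt_trans ig.
rewrite [leRHS](@ge0_integral_pushforward _ _ _ _ _ _ (@measurable_rV_cons R n)
  (lebesgue_measure \x leb n)%E)//.
by apply: measurableT_comp => //; exact/measurable_EFinP.
Qed.

(** [leb n.+1] is by construction the push-forward of [lebesgue_measure \x leb n] under [rV_cons];
    this change of variables gives access to Fubini. *)
Lemma integral_vol_cons n (g : 'rV[R]_n.+1 -> R) :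
  measurable_fun setT g -> vol.-integrable setT (EFin \o g) ->
  (\int[leb n.+1]_x (g x)%:E =
   \int[lebesgue_measure \x leb n]_z (g (rV_cons z))%:E)%E.
Proof.
move=> mg ig.
rewrite [LHS](@integral_pushforward _ _ _ _ _ _ (@measurable_rV_cons R n)
  (lebesgue_measure \x leb n)%E)//.
  exact/measurable_EFinP.
exact: integrable_rV_cons.
Qed.

(** Fubini and induction on the dimension. A derivative in a later coordinate is handled on each
    slice by the induction hypothesis; one in coordinate 0 is integrated first along lines, by the
    fundamental theorem of calculus. *)
Lemma integral_pderiv_vanishing n (i : 'I_n) (f : 'rV[R]_n -> R) (r : R) :
  (forall x, derivable f x (delta_mx ord0 i)) -> continuous (pderiv i f) ->
  (forall x, ~ rV_box r x -> f x = 0) ->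
  (\int[vol]_x (pderiv i f x)%:E = 0)%E.
Proof.
elim: n => [|n IHn] in i f *; first by case: i.
move=> df cf f0.
have ig := integrable_vanishing_outside_box cf
  (fun x => derive_vanishing (delta_mx ord0 i) (@closed_box n.+1 r) f0).
have mg := @continuous_rV_measurable_fun R n.+1 _ setT cf.
have ig' := integrable_rV_cons mg ig.
rewrite integral_vol_cons//.
have [j|] := unliftP ord0 i => ij.
  rewrite -integral12_prod_meas1//= /fubini_F/=.
  apply: integral0_eq => t _.
  pose ft x := f (rV_cons (t, x)).
  (* Slice and full function have the same difference quotients, so existence and value of the
     derivative transfer together. *)
  have E x : (fun h : R => h^-1 *: ((ft \o shift x) (h *: delta_mx ord0 j) - ft x))
     = (fun h : R => h^-1 *: ((f \o shift (rV_cons (t, x))) (h *: delta_mx ord0 i)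
        - f (rV_cons (t, x)))).
    apply/funext => h /=; congr (_ *: (f _ - _)); apply/rowP => k.
    rewrite !mxE ij eqxx/=; case: unliftP => [l|] -> /=.
      by rewrite !mxE (inj_eq lift_inj).
    by rewrite mulr0 add0r.
  have pE x : pderiv j ft x = pderiv i f (rV_cons (t, x)).
    by rewrite /pderiv /derive E.
  rewrite -(IHn j ft).
  - by apply: eq_integral => x _; rewrite pE.
  - by move=> x; rewrite /derivable E; exact: df.
  - rewrite (_ : pderiv j ft = pderiv i f \o (fun x => rV_cons (t, x))).
      move=> x; apply: continuous_comp; last exact: cf.
      exact: continuous_rV_cons_r.
    by apply/funext => x; rewrite pE.
  - move=> x bx; apply: f0; apply: contra_not bx => bx k.
    by have := bx (lift ord0 k); rewrite mxE liftK.
rewrite -integral21_prod_meas1//= /fubini_G/=.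
apply: integral0_eq => x _.
pose fx (t : R) := f (rV_cons (t, x)).
have E t : (fun h : R => h^-1 *: ((fx \o shift t) (h *: 1) - fx t))
   = (fun h : R => h^-1 *: ((f \o shift (rV_cons (t, x))) (h *: delta_mx ord0 i)
      - f (rV_cons (t, x)))).
  apply/funext => h /=; congr (_ *: (f _ - _)); apply/rowP => k.
  rewrite !mxE ij eqxx/=; case: unliftP => [l|] -> /=.
    by rewrite mulr0 add0r.
  by [].
have pE t : derive1 fx t = pderiv i f (rV_cons (t, x)).
  by rewrite derive1E /pderiv /derive E.
rewrite -(@integral_derive1_vanishing fx r).
- by apply: eq_integral => t _; rewrite pE.
- by move=> t; rewrite /derivable E; exact: df.
- rewrite (_ : derive1 fx = pderiv i f \o (fun t => rV_cons (t, x))).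
    move=> t; apply: continuous_comp; last exact: cf.
    exact: continuous_rV_cons_l.
  by apply/funext => t; rewrite pE.
- move=> t bt; apply: f0; apply: contra_not bt => /(_ ord0).
  by rewrite mxE unlift_none.
Qed.

End vanishing_outside_box.

(** * Bounded renormalisations of test functions *)

Section test_functions.
Context {R : realType} {n : nat}.
Implicit Types (U : set 'rV[R]_n) (f g : 'rV[R]_n -> R).

(** Smoothness is proved by exhibiting a class of regular functions stable under differentiation,
    which avoids any formula for iterated derivatives. *)
Lemma smooth_closed_under_pderiv (P : ('rV[R]_n -> R) -> Prop) :
  (forall g, P g -> continuous g /\
     forall i x, derivable g x (delta_mx ord0 i)) ->
  (forall g i, P g -> P (pderiv i g)) ->
  forall f, P f -> smooth f.
Proof.
move=> Preg Pder f Pf s /=.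
suff : P (foldr pderiv f s) by exact: Preg.
by elim: s => //= i s Ps; exact: Pder.
Qed.

Lemma smooth_pderiv i f : smooth f -> smooth (pderiv i f).
Proof.
by move=> sf s; have := sf (rcons s i); rewrite foldr_rcons.
Qed.

Lemma smooth_continuous f : smooth f -> continuous f.
Proof. by move=> /(_ [::])[]. Qed.

Lemma smooth_derivable f i x : smooth f -> derivable f x (delta_mx ord0 i).
Proof. by move=> /(_ [::])[]. Qed.

Section renormalization.
Variables (m : nat) (kappa : R) (Phi : 'I_m -> 'rV[R]_n -> R).
Hypothesis kappa0 : 0 < kappa.
Hypothesis sPhi : forall j, smooth (Phi j).

Definition sqlen (x : 'rV[R]_n) : R := \sum_j Phi j x ^+ 2.

Definition damping (x : 'rV[R]_n) : R := (1 + kappa * sqlen x)^-1.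

(** The denominator written with operations on functions, the form from which its derivative is
    inferred. *)
Let q : 'rV[R]_n -> R := cst 1 + cst kappa * \sum_j (Phi j * Phi j).

Let qE x : q x = 1 + kappa * sqlen x.
Proof.
by rewrite /q /sqlen !fctE fct_sumE.
Qed.

Let q_gt0 x : 0 < q x.
Proof.
rewrite qE ltr_wpDr// mulr_ge0 ?(ltW kappa0)//.
by apply: sumr_ge0 => j _; exact: sqr_ge0.
Qed.

(** The algebra generated by the constants, all derivatives of the [Phi j] and [damping]. It is
    stable under differentiation because the derivative of [damping] is $-2\kappa$ [damping]$^2
    \sum_j \Phi_j \partial_i\Phi_j$. *)
Inductive damped_jet : ('rV[R]_n -> R) -> Prop :=
| damped_cst c : damped_jet (cst c)
| damped_deriv j s : damped_jet (foldr pderiv (Phi j) s)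
| damped_damping : damped_jet damping
| damped_add f g : damped_jet f -> damped_jet g -> damped_jet (f + g)
| damped_mul f g : damped_jet f -> damped_jet g -> damped_jet (f * g).

Let dampingE : damping = (fun x => (q x)^-1).
Proof. by apply/funext => x; rewrite /damping qE. Qed.

Let cq : continuous q.
Proof.
have cS : continuous (\sum_j (Phi j * Phi j) : 'rV[R]_n -> R).
  elim/big_ind: _ => [|f g cf cg|j _] x.
  - exact: (@cst_continuous _ _ 0).
  - by apply: continuousD; [exact: cf|exact: cg].
  - by apply: continuousM; exact: smooth_continuous.
move=> x; apply: continuousD; first exact: cst_continuous.
by apply: continuousM; [exact: cst_continuous|exact: cS].
Qed.

Let is_derive_q i x :
  is_derive x (delta_mx ord0 i) q
    (2 * kappa * \sum_j Phi j x * pderiv i (Phi j) x).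
Proof.
have dPhi j : is_derive x (delta_mx ord0 i) (Phi j) (pderiv i (Phi j) x).
  by apply: derivableP; exact: smooth_derivable.
apply: is_derive_eq.
rewrite add0r !fctE scaler0 addr0 scaler_sumr mulr_sumr.
by apply: eq_bigr => j _; rewrite /GRing.scale/=; ring.
Qed.

Let is_derive_damping i x :
  is_derive x (delta_mx ord0 i) damping
    (- (2 * kappa) * damping x ^+ 2 * \sum_j Phi j x * pderiv i (Phi j) x).
Proof.
have [dq Dq] := is_derive_q i x.
apply: DeriveDef.
  rewrite dampingE; apply: derivableV; last exact: dq.
  by rewrite gt_eqF.
rewrite dampingE deriveV ?gt_eqF//.
by rewrite Dq /GRing.scale/= -exprVn; ring.
Qed.

Lemma smooth_damping : smooth damping.
Proof.
apply: (@smooth_closed_under_pderiv damped_jet); last exact: damped_damping.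
  move=> g; elim=> {g} [c|j s||f g _ [cf df] _ [cg dg]|f g _ [cf df] _ [cg dg]].
  - by split=> [x|i x]; [exact: cst_continuous|exact: derivable_cst].
  - exact: sPhi.
  - split=> [|i x]; last by case: (is_derive_damping i x).
    rewrite dampingE => x; apply: continuousV; last exact: cq.
    exact: lt0r_neq0.
  - split=> [x|i x]; first by apply: continuousD; [exact: cf|exact: cg].
    by apply: derivableD; [exact: df|exact: dg].
  - split=> [x|i x]; first by apply: continuousM; [exact: cf|exact: cg].
    by apply: derivableM; [exact: df|exact: dg].
move=> g i Pg.
suff : (forall x, derivable g x (delta_mx ord0 i)) /\ damped_jet (pderiv i g).
  by case.
elim: Pg => {g} [c|j s||f g Pf [df Pdf] Pg [dg Pdg]|f g Pf [df Pdf] Pg [dg Pdg]].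
- split=> [x|]; first exact: derivable_cst.
  rewrite (_ : pderiv i _ = cst 0); first exact: damped_cst.
  by apply/funext => x; rewrite /pderiv derive_cst.
- split=> [x|]; first exact: (sPhi j s).2.
  exact: (damped_deriv j (i :: s)).
- split=> [x|]; first by case: (is_derive_damping i x).
  rewrite (_ : pderiv i _ = cst (- (2 * kappa)) * (damping * damping) *
      \sum_j (Phi j * pderiv i (Phi j))).
    apply: damped_mul.
      apply: damped_mul; first exact: damped_cst.
      by apply: damped_mul; exact: damped_damping.
    elim/big_ind: _ => [|f g|j _].
    + exact: (damped_cst 0).
    + exact: damped_add.
    + by apply: damped_mul; [exact: (damped_deriv j [::])|
        exact: (damped_deriv j [:: i])].
  apply/funext => x; have [_ dE] := is_derive_damping i x.
  by rewrite /pderiv dE !fctE fct_sumE.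
- split=> [x|]; first exact: derivableD.
  rewrite (_ : pderiv i _ = pderiv i f + pderiv i g); first exact: damped_add.
  by apply/funext => x; rewrite /pderiv deriveD.
- split=> [x|]; first exact: derivableM.
  rewrite (_ : pderiv i _ = f * pderiv i g + g * pderiv i f).
    by apply: damped_add; exact: damped_mul.
  by apply/funext => x; rewrite /pderiv deriveM.
Qed.

(** This is $G_\kappa$ composed with [Phi]. Subtracting from 1 makes it vanish wherever all [Phi j]
    vanish, which gives compact support. *)
Definition renorm (x : 'rV[R]_n) : R := 1 - damping x.

Lemma pderiv_renorm i x :
  pderiv i renorm x =
  2 * kappa * damping x ^+ 2 * \sum_j Phi j x * pderiv i (Phi j) x.
Proof.
have dd := is_derive_damping i x.
rewrite /pderiv (_ : renorm = cst 1 - damping)//.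
by rewrite derive_val add0r !mulNr opprK.
Qed.

Lemma smooth_renorm : smooth renorm.
Proof.
have sd := smooth_damping.
pose P g := g = renorm \/ smooth g.
apply: (@smooth_closed_under_pderiv P); last by left.
  move=> g [->|/(_ [::])//]; split=> [x|i x].
    rewrite (_ : renorm = cst 1 - damping)//.
    by apply: continuousB; [exact: cst_continuous|exact: smooth_continuous].
  rewrite (_ : renorm = cst 1 - damping)//; apply: derivableB.
    exact: derivable_cst.
  exact: smooth_derivable.
move=> g i [->|sg]; right; last exact: smooth_pderiv.
rewrite (_ : pderiv i renorm = - pderiv i damping); last first.
  apply/funext => x; rewrite /pderiv (_ : renorm = cst 1 - damping)//.
  rewrite deriveB; [|exact: derivable_cst|exact: smooth_derivable].
  by rewrite derive_cst sub0r.
pose Q g := exists2 h, smooth h & g = - h.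
apply: (@smooth_closed_under_pderiv Q).
- move=> _ [h sh ->]; split=> [x|j x].
    by apply: continuousN; exact: smooth_continuous.
  by apply: derivableN; exact: smooth_derivable.
- move=> _ j [h sh ->]; exists (pderiv j h); first exact: smooth_pderiv.
  by apply/funext => x; rewrite /pderiv deriveN//; exact: smooth_derivable.
- by exists (pderiv i damping) => //; exact: smooth_pderiv.
Qed.

End renormalization.

(** The support lies in the finite union [K] of the supports of the [Phi j], a compact subset of
    [U]. *)
Lemma test_function_renorm U m (kappa : R) (Phi : 'I_m -> 'rV[R]_n -> R) :
  0 < kappa -> (forall j, test_function U (Phi j)) ->
  test_function U (renorm kappa Phi).
Proof.
move=> k0 tPhi.
pose K := \bigcup_(j in [set: 'I_m]) closure [set x | Phi j x != 0].
have cK : compact K.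
  rewrite /K (_ : setT = [set` index_enum 'I_m]); last first.
    by apply/seteqP; split => j //= _; rewrite mem_index_enum.
  rewrite bigcup_seq; elim/big_ind: _ => [|A B cA cB|j _].
  - exact: compact0.
  - exact: compactU.
  - by have [] := tPhi j.
have sub : closure [set x | renorm kappa Phi x != 0] `<=` K.
  have clK : closed K by apply: compact_closed => //; exact: norm_hausdorff.
  rewrite (closure_id K).1//; apply: closure_subset => x /= rx.
  apply: contrapT => Kx; move/eqP: rx; apply.
  rewrite /renorm /damping /sqlen big1 ?mulr0 ?addr0 ?invr1 ?subrr// => j _.
  suff -> : Phi j x = 0 by rewrite expr0n.
  apply: contrapT => Px; apply: Kx; exists j => //.
  by apply: subset_closure => /=; exact/eqP.
split.
- by apply: smooth_renorm => // j; have [] := tPhi j.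
- by apply: subclosed_compact cK sub; exact: closed_closure.
- by apply: subset_trans sub _ => x [j _]; have [_ _] := tPhi j; apply.
Qed.

Let support_vanishing f y : ~ closure [set x | f x != 0] y -> f y = 0.
Proof.
move=> yK; apply: contrapT => fy; apply: yK.
by apply: subset_closure => /=; exact/eqP.
Qed.

Let pderiv_support_vanishing f i x :
  ~ closure [set x | f x != 0] x -> pderiv i f x = 0.
Proof.
move=> xK.
exact: (derive_vanishing (delta_mx ord0 i)
  (@closed_closure _ [set x | f x != 0]) (@support_vanishing f) xK).
Qed.

Lemma test_function_pderiv0 U f i x :
  test_function U f -> ~ U x -> pderiv i f x = 0.
Proof. by move=> [_ _ KU] Ux; apply: pderiv_support_vanishing => /KU. Qed.

Lemma test_function_box U f : test_function U f ->
  exists r : R, forall x, ~ rV_box r x -> f x = 0 /\ forall i, pderiv i f x = 0.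
Proof.
move=> [_ cK KU]; have [r r0 Kr] := bounded_rV_box (compact_bounded cK).
exists r => x xr.
have xK : ~ closure [set x | f x != 0] x by move=> /Kr.
by split=> [|i]; [exact: support_vanishing|exact: pderiv_support_vanishing].
Qed.

Lemma test_function_L2 U f : measurable U -> test_function U f -> L2 U f.
Proof.
move=> mU tf; have cf : continuous f by case: tf => /smooth_continuous.
have [r fr] := test_function_box tf.
split; first exact: continuous_rV_measurable_fun.
apply: (@integrableS _ _ _ _ setT) => //.
apply: (@integrable_vanishing_outside_box _ _ _ r).
  by move=> x; apply: continuousM; exact: cf.
by move=> x /fr[-> _]; rewrite expr0n.
Qed.

Lemma test_function_pderiv_L2 U f i :
  measurable U -> test_function U f -> L2 U (pderiv i f).
Proof.
move=> mU tf; have cf : continuous (pderiv i f).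
  by case: tf => /(smooth_pderiv i)/smooth_continuous.
have [r fr] := test_function_box tf.
split; first exact: continuous_rV_measurable_fun.
apply: (@integrableS _ _ _ _ setT) => //.
apply: (@integrable_vanishing_outside_box _ _ _ r).
  by move=> x; apply: continuousM; exact: cf.
by move=> x /fr[_ ->]; rewrite expr0n.
Qed.

Lemma integral_pderiv_test_function U f i : measurable U -> test_function U f ->
  \int[vol]_(x in U) pderiv i f x = 0.
Proof.
move=> mU tf; have [r fr] := test_function_box tf.
rewrite Rintegral_mkcond (_ : _ \_ U = pderiv i f); last first.
  apply/funext => x; rewrite patchE; case: ifPn => //.
  by rewrite notin_setE => /(test_function_pderiv0 i tf) ->.
rewrite /Rintegral (@integral_pderiv_vanishing _ _ i f r)//.
- by move=> x; apply: smooth_derivable; case: tf.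
- by apply: smooth_continuous; apply: smooth_pderiv; case: tf.
- by move=> x /fr[].
Qed.

End test_functions.

(** * Square-integrable functions *)

Section real_integrals.
Context d (T : measurableType d) (R : realType) (mu : {measure set T -> \bar R}).
Variables (D : set T) (mD : measurable D).
Implicit Types f g : T -> R.

Lemma dominated_integrable f g : measurable_fun D f ->
  mu.-integrable D (EFin \o g) -> (forall x, D x -> `|f x| <= g x) ->
  mu.-integrable D (EFin \o f).
Proof.
move=> mf ig fg; apply: le_integrable ig => //; first exact/measurable_EFinP.
by move=> x Dx /=; rewrite lee_fin (le_trans (fg _ Dx))// ler_norm.
Qed.

Lemma ae_dominated_integrable f g : measurable_fun D f ->
  mu.-integrable D (EFin \o g) -> {ae mu, forall x, D x -> `|f x| <= g x} ->
  mu.-integrable D (EFin \o f).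
Proof.
move=> mf /integrableP[/measurable_EFinP mg ig] fg; apply/integrableP; split.
  exact/measurable_EFinP.
apply: le_lt_trans ig; apply: ae_ge0_le_integral => //.
- by apply/measurable_EFinP; exact: measurableT_comp.
- by apply/measurable_EFinP; exact: measurableT_comp.
- apply: filterS fg => x fg Dx /=.
  by rewrite lee_fin (le_trans (fg Dx))// ler_norm.
Qed.

Lemma ae_le_Rintegral f g :
  mu.-integrable D (EFin \o f) -> mu.-integrable D (EFin \o g) ->
  {ae mu, forall x, D x -> f x <= g x} ->
  \int[mu]_(x in D) f x <= \int[mu]_(x in D) g x.
Proof.
move=> /[dup] intf /integrableP[/measurable_EFinP mf _].
move=> /[dup] intg /integrableP[/measurable_EFinP mg _] fg.
rewrite -subr_ge0 -RintegralB//.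
(* The difference is nonnegative only almost everywhere; its absolute value has the same integral
   and is nonnegative everywhere. *)
rewrite (_ : \int[mu]_(x in D) _ = \int[mu]_(x in D) `|g x - f x|).
  by apply: Rintegral_ge0.
have mgf : measurable_fun D (fun x => g x - f x) by exact: measurable_funB.
congr fine; apply: ae_eq_integral => //.
- exact/measurable_EFinP.
- by apply/measurable_EFinP; exact: measurableT_comp.
- by apply: filterS fg => x fg Dx; rewrite ger0_norm// subr_ge0 fg.
Qed.

Lemma Rintegral_eq0_ae f : measurable_fun D f ->
  {ae mu, forall x, D x -> f x = 0} -> \int[mu]_(x in D) f x = 0.
Proof.
move=> mf f0; rewrite /Rintegral (@ae_eq_integral _ _ _ mu D (cst 0%E))//.
- by rewrite integral0.
- exact/measurable_EFinP.
- by apply: filterS f0 => x f0 Dx /=; rewrite f0.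
Qed.

Lemma integrable_Rsum (I : Type) (s : seq I) (F : I -> T -> R) :
  (forall i, mu.-integrable D (EFin \o F i)) ->
  mu.-integrable D (EFin \o (fun x => \sum_(i <- s) F i x)).
Proof.
move=> iF; rewrite (_ : _ \o _ = (fun x => \sum_(i <- s) (F i x)%:E)%E).
  by apply: integrable_sum => // i _; exact: iF.
by apply/funext => x /=; rewrite sumEFin.
Qed.

Lemma Rintegral_sum (I : Type) (s : seq I) (F : I -> T -> R) :
  (forall i, mu.-integrable D (EFin \o F i)) ->
  \int[mu]_(x in D) (\sum_(i <- s) F i x) = \sum_(i <- s) \int[mu]_(x in D) F i x.
Proof.
move=> iF; elim: s => [|i s IHs].
  under eq_Rintegral do rewrite big_nil.
  by rewrite big_nil Rintegral_cst// mul0r.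
rewrite big_cons -IHs -RintegralD//; last exact: integrable_Rsum.
by apply: eq_Rintegral => x _; rewrite big_cons.
Qed.

(* An infinite integral is sent to 0 by [fine]. *)
Lemma Rintegral_not_integrable f : measurable_fun D f ->
  ~ mu.-integrable D (EFin \o f) -> \int[mu]_(x in D) f x = 0.
Proof.
move=> mf nif; rewrite /Rintegral.
have mEf : measurable_fun D (EFin \o f) by exact/measurable_EFinP.
case E : (\int[mu]_(x in D) (f x)%:E)%E => [r| |] //.
exfalso; apply: nif; apply/integrableP; split=> //.
by rewrite /= integral_fin_num_abs// E.
Qed.

(** Dominated convergence with majorant [f]: at each point the excess is 0 once [n] passes the value
    of [f]. This controls the truncation error in the convective term. *)
Lemma Rintegral_excess_cvg0 f : (forall x, D x -> 0 <= f x) ->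
  mu.-integrable D (EFin \o f) ->
  \int[mu]_(x in D) Num.max (f x - n%:R) 0 @[n --> \oo] --> (0 : R).
Proof.
move=> f0 /[dup] intf /integrableP[/measurable_EFinP mf _].
pose g (n : nat) x := (Num.max (f x - n%:R) 0)%:E.
have mg n : measurable_fun D (g n).
  apply/measurable_EFinP; apply: measurable_maxr => //.
  exact: measurable_funB.
have gf : {ae mu, forall x n, D x -> (`|g n x| <= (EFin \o f) x)%E}.
  apply: aeW => x n Dx; rewrite /= lee_fin ger0_norm ?le_max ?lexx ?orbT//.
  by rewrite ge_max f0// andbT lerBlDr lerDl.
have g0 : {ae mu, forall x, D x -> g ^~ x @ \oo --> (cst 0%E : T -> \bar R) x}.
  apply: aeW => x Dx; apply: cvg_near_cst.
  exists (Num.truncn (f x)).+1 => // n /= xn; rewrite /g; congr EFin.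
  apply/max_idPr; rewrite subr_le0 ltW//.
  by rewrite (lt_le_trans (truncnS_gt _))// ler_nat.
have [_ _ cg] := @dominated_convergence _ _ _ mu D mD g (cst 0%E) (EFin \o f)
  mg (measurable_cst _) g0 intf gf.
rewrite (_ : (fun n => _) = fine \o (fun n => \int[mu]_(x in D) g n x)%E)//.
by apply: fine_cvg; rewrite integral0 in cg.
Qed.

End real_integrals.

Section L2_calculus.
Context {R : realType} {n : nat} (U : set 'rV[R]_n).
Hypothesis mU : measurable U.
Implicit Types f g : 'rV[R]_n -> R.

Lemma L2M_integrable f g : L2 U f -> L2 U g ->
  vol.-integrable U (EFin \o (fun x => f x * g x)).
Proof.
move=> [mf intf] [mg intg].
apply: (@dominated_integrable _ _ _ _ _ mU _ (fun x => f x ^+ 2 + g x ^+ 2)).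
- exact: measurable_funM.
- exact: (integrableD mU intf intg).
- move=> x _; rewrite normrM -(real_normK (num_real (f x))).
  rewrite -(real_normK (num_real (g x))).
  have := sqr_ge0 (`|f x| - `|g x|).
  by have := mulr_ge0 (normr_ge0 (f x)) (normr_ge0 (g x)); nra.
Qed.

Lemma L2_sqr_integrable f :
  L2 U f -> vol.-integrable U (EFin \o (fun x => f x ^+ 2)).
Proof. by case. Qed.

Lemma L2D f g : L2 U f -> L2 U g -> L2 U (fun x => f x + g x).
Proof.
move=> [mf intf] [mg intg]; split; first exact: measurable_funD.
apply: (@dominated_integrable _ _ _ _ _ mU _ (fun x => 2 * (f x ^+ 2 + g x ^+ 2))).
- by apply: measurable_funX; exact: measurable_funD.
- exact: (integrableZl mU 2 (integrableD mU intf intg)).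
- move=> x _; rewrite ger0_norm ?sqr_ge0//.
  by have := sqr_ge0 (f x - g x); nra.
Qed.

Lemma L2Z c f : L2 U f -> L2 U (fun x => c * f x).
Proof.
move=> [mf intf]; split; first exact: measurable_funM.
rewrite (_ : (fun x => _) = (fun x => (c ^+ 2)%:E * (f x ^+ 2)%:E)%E).
  exact: integrableZl.
by apply/funext => x; rewrite -EFinM exprMn.
Qed.

Lemma L2B f g : L2 U f -> L2 U g -> L2 U (fun x => f x - g x).
Proof.
move=> Lf Lg; rewrite (_ : (fun x => _) = (fun x => f x + (-1) * g x)).
  by apply: L2D => //; exact: L2Z.
by apply/funext => x; rewrite mulN1r.
Qed.

Lemma L2_sum (I : Type) (s : seq I) (F : I -> 'rV[R]_n -> R) :
  (forall i, L2 U (F i)) -> L2 U (fun x => \sum_(i <- s) F i x).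
Proof.
move=> LF; elim: s => [|i s IHs].
  rewrite (_ : (fun x => _) = cst 0); last by apply/funext => x; rewrite big_nil.
  split; first exact: measurable_cst.
  rewrite (_ : (fun x => _) = cst 0%E); first exact: integrable0.
  by apply/funext => x /=; rewrite expr0n.
rewrite (_ : (fun x => _) = (fun x => F i x + \sum_(i <- s) F i x)).
  exact: L2D.
by apply/funext => x; rewrite big_cons.
Qed.

Lemma L2_bounded_mul (M : R) f g : measurable_fun U f ->
  (forall x, U x -> `|f x| <= M) -> L2 U g -> L2 U (fun x => f x * g x).
Proof.
move=> mf fM [mg intg]; split; first exact: measurable_funM.
apply: (@dominated_integrable _ _ _ _ _ mU _ (fun x => M ^+ 2 * g x ^+ 2)).
- by apply: measurable_funX; exact: measurable_funM.
- exact: (integrableZl mU (M ^+ 2) intg).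
- move=> x Ux; rewrite ger0_norm ?sqr_ge0// exprMn ler_wpM2r ?sqr_ge0//.
  rewrite -(real_normK (num_real (f x))) lerXn2r ?nnegrE// ?fM//.
  exact: le_trans (fM _ Ux).
Qed.

Lemma L2_cst (c : R) : (vol U < +oo)%E -> L2 U (cst c).
Proof.
move=> Uoo; split; first exact: measurable_cst.
apply: (@measurable_bounded_integrable _ _ _ _ (cst (c ^+ 2))) => //.
by exists `|c ^+ 2|; split=> [|z Mz x _]; [exact: num_real|exact: ltW].
Qed.

Lemma L2_integrable f : (vol U < +oo)%E -> L2 U f -> vol.-integrable U (EFin \o f).
Proof.
move=> Uoo Lf; have := L2M_integrable (L2_cst 1 Uoo) Lf.
by under [X in _.-integrable _ (_ \o X)]eq_fun do rewrite mul1r.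
Qed.

End L2_calculus.

(** * Approximation in $H^1_0$ and vanishing of the divergence *)

Section H10_calculus.
Context {R : realType} {n : nat} (U : set 'rV[R]_n).
Hypothesis mU : measurable U.
Implicit Types f g : 'rV[R]_n -> R.

Lemma small_eq0 (a C : R) : (forall e, 0 < e -> `|a| <= C * e) -> a = 0.
Proof.
move=> aC; apply/eqP; rewrite -normr_le0 leNgt; apply/negP => a0.
have C0 : 0 < `|C| + 1 by rewrite ltr_wpDl.
have := aC (`|a| / (2 * (`|C| + 1))); rewrite divr_gt0 ?mulr_gt0// => /(_ isT).
apply/negP; rewrite -ltNge.
rewrite [ltRHS](_ : _ = (`|C| + 1) * (`|a| / (`|C| + 1))); last first.
  by field; rewrite gt_eqF.
apply: (@le_lt_trans _ _ (`|C| * (`|a| / (2 * (`|C| + 1))))).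
  by rewrite ler_wpM2r ?ler_norm// divr_ge0 ?mulr_ge0// addr_ge0.
have -> : `|a| / (2 * (`|C| + 1)) = `|a| / (`|C| + 1) / 2.
  by field; rewrite gt_eqF.
have : 0 < `|a| / (`|C| + 1) by rewrite divr_gt0.
by have := normr_ge0 C; nra.
Qed.

(** Expand $e^{-1}(ea \pm b)^2 \ge 0$. When $b$ has squared $L^2$ norm at most $e^2$, the right-hand
    side integrates to $O(e)$, so this replaces Cauchy-Schwarz in the approximation arguments. *)
Lemma young (e a b : R) : 0 < e -> `|a * b| <= (e * a ^+ 2 + e^-1 * b ^+ 2) / 2.
Proof.
move=> e0; have ei0 : 0 < e^-1 by rewrite invr_gt0.
have ei : e * e^-1 = 1 by rewrite divff// gt_eqF.
rewrite ler_norml; apply/andP; split.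
  have : 0 <= e^-1 * (e * a + b) ^+ 2 by rewrite mulr_ge0 ?sqr_ge0// ltW.
  have -> : e^-1 * (e * a + b) ^+ 2 =
      e * e^-1 * (e * a ^+ 2 + 2 * a * b) + e^-1 * b ^+ 2 by ring.
  by rewrite ei; lra.
have : 0 <= e^-1 * (e * a - b) ^+ 2 by rewrite mulr_ge0 ?sqr_ge0// ltW.
have -> : e^-1 * (e * a - b) ^+ 2 =
    e * e^-1 * (e * a ^+ 2 - 2 * a * b) + e^-1 * b ^+ 2 by ring.
by rewrite ei; lra.
Qed.

Lemma weak_pderivP f i : weakly_derivable U i f ->
  is_weak_pderiv U i f (weak_pderiv U i f).
Proof. by move=> h; have := getPex h. Qed.

Lemma weak_pderiv_measurable f i : weakly_derivable U i f ->
  measurable_fun U (weak_pderiv U i f).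
Proof. by move=> /weak_pderivP[_ [] ]. Qed.

Lemma H10_L2 f : H10 U f -> L2 U f.
Proof. by case=> -[]. Qed.

Lemma H10_weak_pderiv_L2 f i : H10 U f -> L2 U (weak_pderiv U i f).
Proof. by case=> -[_ /(_ i)[]]. Qed.

Lemma H10_approx f (e : R) : H10 U f -> 0 < e ->
  exists phi, [/\ test_function U phi,
    \int[vol]_(x in U) ((f x - phi x) ^+ 2) <= e ^+ 2 &
    forall i, \int[vol]_(x in U) ((weak_pderiv U i f x - pderiv i phi x) ^+ 2)
      <= e ^+ 2].
Proof.
move=> [_ /[apply]] [phi tphi fphi]; exists phi; split=> //.
  apply: le_trans (ltW fphi); rewrite lerDl; apply: sumr_ge0 => i _.
  by apply: Rintegral_ge0 => x _; exact: sqr_ge0.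
move=> i; apply: le_trans (ltW fphi); rewrite (bigD1 i)//=.
rewrite addrCA lerDl addr_ge0//.
  by apply: Rintegral_ge0 => x _; exact: sqr_ge0.
apply: sumr_ge0 => j _.
by apply: Rintegral_ge0 => x _; exact: sqr_ge0.
Qed.

(** Derivatives of test functions have integral 0 and approximate the weak derivative in $L^2$,
    hence in $L^1$ as the volume is finite. The constant comes from Young's inequality: $\frac e2
    |U| + \frac{1}{2e} e^2$. *)
Lemma H10_weak_pderiv_mean0 f i : (vol U < +oo)%E -> H10 U f ->
  \int[vol]_(x in U) weak_pderiv U i f x = 0.
Proof.
move=> Uoo Hf; apply: (@small_eq0 _ ((fine (vol U) + 1) / 2)) => e e0.
have [phi [tphi _ /(_ i) fphi]] := H10_approx Hf e0.
have Lw := H10_weak_pderiv_L2 i Hf.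
have Lp := test_function_pderiv_L2 i mU tphi.
have Ld := L2B mU Lw Lp.
rewrite -[X in `|X|]subr0 -(integral_pderiv_test_function i mU tphi).
rewrite -RintegralB//; [|exact: L2_integrable..].
have Id := L2_integrable mU Uoo Ld.
apply: le_trans (le_normr_Rintegral mU Id) _.
have Ie := L2_integrable mU Uoo (L2_cst mU (e / 2) Uoo).
have Is : vol.-integrable U (EFin \o (fun x => e^-1 / 2 *
    (weak_pderiv U i f x - pderiv i phi x) ^+ 2)).
  exact: (integrableZl mU (e^-1 / 2) (L2_sqr_integrable Ld)).
apply: (@le_trans _ _ (\int[vol]_(x in U) (e / 2 + e^-1 / 2 *
    (weak_pderiv U i f x - pderiv i phi x) ^+ 2))).
  apply: le_Rintegral => //.
  - exact: integrable_norm.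
  - exact: (integrableD mU Ie Is).
  - move=> x Ux; have := young 1 (weak_pderiv U i f x - pderiv i phi x) e0.
    by rewrite mul1r; lra.
rewrite (RintegralD mU Ie Is) (RintegralZl _ mU (L2_sqr_integrable Ld)).
rewrite Rintegral_cst//.
apply: (@le_trans _ _ (e / 2 * fine (vol U) + e^-1 / 2 * e ^+ 2)).
  by rewrite lerD2l ler_wpM2l// divr_ge0// invr_ge0 ltW.
rewrite le_eqVlt; apply/orP; left; apply/eqP; field.
by rewrite gt_eqF.
Qed.

Lemma divergence_trace (w : 'rV[R]_n -> 'rV[R]_n) x :
  divergence U w x = \sum_i weak_pderiv U i (component w i) x.
Proof. by rewrite /divergence /mxtrace; apply: eq_bigr => i _; rewrite mxE. Qed.

Lemma divergence_L20 (w : 'rV[R]_n -> 'rV[R]_n) : (vol U < +oo)%E ->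
  H10_vec U w -> L20 U (divergence U w).
Proof.
move=> Uoo Hw.
have -> : divergence U w = fun x => \sum_i weak_pderiv U i (component w i) x.
  by apply/funext => x; exact: divergence_trace.
have Lw i : L2 U (weak_pderiv U i (component w i)) by exact: H10_weak_pderiv_L2.
split; first exact: L2_sum.
rewrite Rintegral_sum//; last by move=> i; exact: L2_integrable.
by rewrite big1// => i _; exact: H10_weak_pderiv_mean0.
Qed.

(** By [divergence_L20] the divergence is itself an admissible [q], and this choice makes its $L^2$
    norm vanish. *)
Lemma divergence_free_ae (w : 'rV[R]_n -> 'rV[R]_n) : (vol U < +oo)%E ->
  H10_vec U w ->
  (forall q, L20 U q -> \int[vol]_(x in U) (q x * divergence U w x) = 0) ->
  {ae vol, forall x, U x -> divergence U w x = 0}.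
Proof.
move=> Uoo Hw qw; have Lq := divergence_L20 Uoo Hw.
have [[mq iq] _] := Lq.
have ge0 x : U x -> (0 <= (divergence U w x ^+ 2)%:E)%E.
  by move=> _; rewrite lee_fin sqr_ge0.
have : (\int[vol]_(x in U) `|(divergence U w x ^+ 2)%:E| = 0)%E.
  have := qw _ Lq; rewrite /Rintegral.
  under eq_integral do rewrite -expr2.
  move=> i0; under eq_integral do rewrite gee0_abs ?lee_fin ?sqr_ge0//.
  (* [fine] also sends an infinite integral to 0; square integrability excludes that case. *)
  by rewrite -[LHS]fineK ?i0//; exact: integrable_fin_num.
move=> /(ae_eq_integral_abs _ mU); case/integrableP: iq => m2 _ /(_ m2).
apply: filterS => x h /h /= [] /eqP.
by rewrite sqrf_eq0 => /eqP.
Qed.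

End H10_calculus.

(** * The convective term *)

Section damped_vector.
Context {R : realType} (m : nat).
Implicit Types (y z : 'I_m -> R) (kappa : R).

(** Up to the factor $2\kappa$, the $i$-th partial derivative at $y$ of $G_\kappa(y) = 1 -
    1/(1+\kappa|y|^2)$. *)
Definition damped kappa y i : R := (1 + kappa * \sum_k y k ^+ 2)^-1 ^+ 2 * y i.

Let damp kappa y : R := (1 + kappa * \sum_k y k ^+ 2)^-1.

Let dampP kappa y : 0 < kappa -> [/\ 0 < damp kappa y, damp kappa y <= 1 &
  damp kappa y * (1 + kappa * \sum_k y k ^+ 2) = 1].
Proof.
move=> k0; have S0 : 0 <= kappa * \sum_k y k ^+ 2.
  by rewrite mulr_ge0 ?(ltW k0)//; apply: sumr_ge0 => k _; exact: sqr_ge0.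
have d0 : 0 < 1 + kappa * \sum_k y k ^+ 2 by rewrite ltr_wpDr.
split; first by rewrite invr_gt0.
- by rewrite invf_le1// lerDl.
- by rewrite mulVf// gt_eqF.
Qed.

Let le_sumsq y i : y i ^+ 2 <= \sum_k y k ^+ 2.
Proof.
by rewrite (bigD1 i)//= lerDl; apply: sumr_ge0 => k _; exact: sqr_ge0.
Qed.

(** From $t \le 1 + t^2$ with $t = |y_i|$, and $\kappa \le 1$, one gets $\kappa t \le 1 + \kappa
    t^2$. *)
Let damp_coord kappa y i : 0 < kappa -> kappa <= 1 ->
  kappa * (`|y i| * damp kappa y) <= 1.
Proof.
move=> k0 k1; have [r0 r1 rE] := dampP y k0.
rewrite -[leRHS]rE mulrA [leRHS]mulrC ler_wpM2r ?(ltW r0)//.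
have := le_sumsq y i; set S := \sum_k _ => yS.
have : 0 <= kappa * (S - y i ^+ 2) by rewrite mulr_ge0 ?subr_ge0// ltW.
rewrite -(real_normK (num_real (y i))); have := normr_ge0 (y i).
move: `|y i| => t t0; have := sqr_ge0 (t - 1); nra.
Qed.

Let damp_coord2 kappa y i j : 0 < kappa ->
  kappa * (`|y i| * `|y j| * damp kappa y) <= 1.
Proof.
move=> k0; have [r0 r1 rE] := dampP y k0.
rewrite -[leRHS]rE mulrA [leRHS]mulrC ler_wpM2r ?(ltW r0)//.
have := le_sumsq y i; have := le_sumsq y j; set S := \sum_k _.
rewrite -(real_normK (num_real (y i))) -(real_normK (num_real (y j))).
move: `|y i| `|y j| => s t tS sS.
have : s * t <= S by have := sqr_ge0 (s - t); nra.
by nra.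
Qed.

Lemma damped_bounded kappa y i : 0 < kappa -> kappa <= 1 ->
  `|damped kappa y i| <= kappa^-1.
Proof.
move=> k0 k1; have [r0 r1 _] := dampP y k0.
rewrite -(ler_pM2l k0) mulfV ?gt_eqF//; apply: le_trans (damp_coord y i k0 k1).
rewrite ler_wpM2l ?(ltW k0)// /damped -/(damp kappa y) normrM.
rewrite ger0_norm ?sqr_ge0// mulrC ler_wpM2l//.
by rewrite expr2 ler_piMl// ltW.
Qed.

(** With $r, s$ the damping factors at $y, z$, the difference is $r^2(y_i - z_i) + z_i(r-s)(r+s)$,
    which explains the 1 and, by $r+s \le 2$, the 2. Moreover $r - s = rs\kappa(|z|^2 - |y|^2)$
    factors through $z_k - y_k$, and the damping absorbs the products $z_i z_k$ and $z_i y_k$ at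
    cost 1 and $\kappa^{-1}$. *)
Lemma damped_lipschitz kappa y z i : 0 < kappa -> kappa <= 1 ->
  `|damped kappa y i - damped kappa z i| <=
  (1 + 2 * (1 + kappa^-1)) * \sum_k `|y k - z k|.
Proof.
move=> k0 k1; have [r0 r1 rE] := dampP y k0; have [s0 s1 sE] := dampP z k0.
rewrite /damped -/(damp kappa y) -/(damp kappa z).
have yS := @damp_coord kappa y; have zS := damp_coord z i k0 k1.
have zzS := @damp_coord2 kappa z i.
move: r0 r1 rE s0 s1 sE yS zS zzS.
set r := damp kappa y; set s := damp kappa z => r0 r1 rE s0 s1 sE yS zS zzS.
have rs : r - s = r * s * kappa * \sum_k (z k - y k) * (z k + y k).
  have -> : \sum_k (z k - y k) * (z k + y k) = \sum_k z k ^+ 2 - \sum_k y k ^+ 2.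
    by rewrite -sumrB; apply: eq_bigr => k _; ring.
  transitivity (r * (s * (1 + kappa * \sum_k z k ^+ 2)) -
                s * (r * (1 + kappa * \sum_k y k ^+ 2))).
    by rewrite rE sE !mulr1.
  ring.
have Pk k : `|z i| * (r * s * kappa * (`|y k - z k| * (`|z k| + `|y k|))) <=
    (1 + kappa^-1) * `|y k - z k|.
  rewrite (_ : _ * (_ * _) = `|y k - z k| *
    (r * (kappa * (`|z i| * `|z k| * s)) +
     kappa^-1 * ((kappa * (`|z i| * s)) * (kappa * (`|y k| * r))))); last first.
    by field; rewrite gt_eqF.
  rewrite mulrC ler_wpM2r// lerD//.
    rewrite -[leRHS]mulr1; apply: ler_pM => //; first exact: ltW.
    by rewrite mulr_ge0 ?(ltW k0)// mulr_ge0 ?(ltW s0)// mulr_ge0.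
    exact: zzS.
  apply: ler_piMr; first by rewrite invr_ge0 ltW.
  rewrite -[leRHS]mulr1; apply: ler_pM => //.
  - by rewrite mulr_ge0 ?(ltW k0)// mulr_ge0 ?(ltW s0).
  - by rewrite mulr_ge0 ?(ltW k0)// mulr_ge0 ?(ltW r0).
  - exact: (yS k).
have zrs : `|z i| * `|r - s| <= (1 + kappa^-1) * \sum_k `|y k - z k|.
  have rsk : 0 <= r * s * kappa by rewrite !mulr_ge0// ltW.
  rewrite rs normrM (ger0_norm rsk).
  rewrite mulr_sumr.
  apply: (@le_trans _ _ (`|z i| * (r * s * kappa *
      \sum_k `|y k - z k| * (`|z k| + `|y k|)))).
    rewrite ler_wpM2l// ler_wpM2l//.
    apply: le_trans (ler_norm_sum _ _ _) _; apply: ler_sum => k _.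
    by rewrite normrM distrC ler_wpM2l// ler_normD.
  by rewrite !mulr_sumr; apply: ler_sum => k _; exact: Pk.
have -> : r ^+ 2 * y i - s ^+ 2 * z i =
    r ^+ 2 * (y i - z i) + z i * (r - s) * (r + s) by ring.
apply: le_trans (ler_normD _ _) _; rewrite mulrDl mul1r lerD//.
  rewrite normrM ger0_norm ?sqr_ge0// (bigD1 i)//=.
  apply: (@le_trans _ _ `|y i - z i|); last first.
    by rewrite lerDl; apply: sumr_ge0.
  by rewrite ler_piMl// exprn_ile1// ltW.
have rs0 : 0 <= r + s by rewrite addr_ge0// ltW.
rewrite normrM normrM (ger0_norm rs0).
rewrite mulrC -mulrA ler_pM//.
by move: r1 s1; lra.
Qed.

End damped_vector.

(** * Vanishing of the damped flux and removal of the damping *)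

Section skew_symmetry.
Context {R : realType} {n : nat} (U : set 'rV[R]_n).
Hypothesis mU : measurable U.
Hypothesis Uoo : (vol U < +oo)%E.

Lemma measurable_damping m (kappa : R) (w : 'I_m -> 'rV[R]_n -> R) :
  0 < kappa -> (forall k, measurable_fun U (w k)) ->
  measurable_fun U (fun x => (1 + kappa * \sum_k w k x ^+ 2)^-1).
Proof.
move=> k0 mw.
(* The absolute value keeps the denominator positive, hence [h] continuous, on the whole line. *)
pose h (t : R) := (1 + kappa * `|t|)^-1.
have ch : continuous h.
  move=> t; rewrite /h; apply: cvgV.
    by rewrite lt0r_neq0// ltr_wpDr// mulr_ge0// ltW.
  apply: cvgD; first exact: cvg_cst.
  by apply: cvgM; [exact: cvg_cst|exact: norm_continuous].
rewrite (_ : (fun x => _) = h \o (fun x => \sum_k w k x ^+ 2)).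
  apply: measurableT_comp; first exact: continuous_measurable_fun.
  apply: measurable_sum => k; exact: measurable_funX.
apply/funext => x; rewrite /h/= ger0_norm//.
by apply: sumr_ge0 => k _; exact: sqr_ge0.
Qed.

Lemma measurable_damped m (kappa : R) (w : 'I_m -> 'rV[R]_n -> R) i :
  0 < kappa -> (forall k, measurable_fun U (w k)) ->
  measurable_fun U (fun x => damped kappa (w^~ x) i).
Proof.
move=> k0 mw; apply: measurable_funM => //; apply: measurable_funX.
exact: measurable_damping.
Qed.

Variable v : 'I_n -> 'rV[R]_n -> R.
Hypothesis Hv : forall j, H10 U (v j).
Hypothesis div_v : {ae vol, forall x, U x -> \sum_j weak_pderiv U j (v j) x = 0}.

Let Lv j : L2 U (v j). Proof. exact: H10_L2. Qed.

Lemma damped_flux_integrable m (kappa : R) (w z : 'I_m -> 'rV[R]_n -> R) i j :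
  0 < kappa -> kappa <= 1 -> (forall k, measurable_fun U (w k)) ->
  L2 U (z i) ->
  vol.-integrable U
    (EFin \o (fun x => v j x * (damped kappa (w^~ x) i * z i x))).
Proof.
move=> k0 k1 mw Lz; apply: L2M_integrable => //.
apply: (L2_bounded_mul mU (M := kappa^-1)) => //.
  exact: measurable_damped.
by move=> x _; exact: damped_bounded.
Qed.

(** By the chain rule, $2\kappa$ times the sum is $\sum_j \int v_j \partial_j G_\kappa(\Phi)$. As
    $G_\kappa(\Phi)$ is a test function, the weak derivatives of the [v j] turn this into minus the
    integral of the divergence times $G_\kappa(\Phi)$. *)
Lemma damped_flux_test_function m (kappa : R) (Phi : 'I_m -> 'rV[R]_n -> R) :
  0 < kappa -> kappa <= 1 -> (forall i, test_function U (Phi i)) ->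
  \sum_j \sum_i \int[vol]_(x in U)
    (v j x * (damped kappa (Phi^~ x) i * pderiv j (Phi i) x)) = 0.
Proof.
move=> k0 k1 tPhi.
have tG := test_function_renorm k0 tPhi.
have sPhi i : smooth (Phi i) by case: (tPhi i).
have Lp i j := test_function_pderiv_L2 j mU (tPhi i).
have mP i : measurable_fun U (Phi i) by case: (test_function_L2 mU (tPhi i)).
have Ij i j : vol.-integrable U (EFin \o (fun x => v j x *
    (damped kappa (Phi^~ x) i * pderiv j (Phi i) x))).
  exact: (@damped_flux_integrable m kappa Phi (fun i => pderiv j (Phi i)) i j).
have Ld j : L2 U (weak_pderiv U j (v j)) by exact: H10_weak_pderiv_L2.
have LG := test_function_L2 mU tG.
apply: (@mulfI _ (2 * kappa)); first by rewrite mulf_neq0 ?gt_eqF.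
rewrite mulr0 mulr_sumr.
transitivity (\sum_j - \int[vol]_(x in U)
    (weak_pderiv U j (v j) x * renorm kappa Phi x)).
  apply: eq_bigr => j _; rewrite -Rintegral_sum//.
  rewrite -RintegralZl//; last exact: integrable_Rsum.
  have [_ _ /(_ _ tG) <-] := weak_pderivP (proj1 ((Hv j).1.2 j)).
  apply: eq_Rintegral => x _; rewrite pderiv_renorm//.
  rewrite /damping /sqlen /damped !mulr_sumr.
  by apply: eq_bigr => i _; ring.
rewrite sumrN -Rintegral_sum//; last by move=> j; exact: L2M_integrable.
rewrite Rintegral_eq0_ae ?oppr0//.
  by apply: measurable_sum => j; apply: measurable_funM; [case: (Ld j)|case: LG].
apply: filterS div_v => x h /h h0.
by rewrite -mulr_suml h0 mul0r.
Qed.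

Lemma ler_addeps (a b C : R) : (forall e, 0 < e -> a <= b + C * e) -> a <= b.
Proof.
move=> abC; rewrite leNgt; apply/negP => ab.
have C0 : 0 < `|C| + 1 by rewrite ltr_wpDl.
have e0 : 0 < (a - b) / (`|C| + 1) by rewrite divr_gt0// subr_gt0.
have := abC _ e0; apply/negP; rewrite -ltNge -ltrBrDl.
apply: (@le_lt_trans _ _ (`|C| * ((a - b) / (`|C| + 1)))).
  by rewrite ler_wpM2r ?ler_norm// ltW.
rewrite [ltRHS](_ : _ = (`|C| + 1) * ((a - b) / (`|C| + 1))).
  by rewrite ltr_pM2r// ltrDl.
by field; rewrite gt_eqF.
Qed.

(* Truncating [h = |v dw|] at height [L] splits the error into a part that is
   small because [h] is integrable and a part that is small in [L2]. *)
Lemma damped_flux_error m (kappa L e : R) (w z : 'I_m -> R) (a dw dz : R) i :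
  0 < kappa -> kappa <= 1 -> 0 <= L -> 0 < e ->
  `|a * (damped kappa w i * dw) - a * (damped kappa z i * dz)| <=
  kappa^-1 * ((e * a ^+ 2 + e^-1 * (dw - dz) ^+ 2) / 2) +
  (2 * kappa^-1 * Num.max (`|a * dw| - L) 0 +
   L * (1 + 2 * (1 + kappa^-1)) *
     \sum_k ((e + e^-1 * (w k - z k) ^+ 2) / 2)).
Proof.
move=> k0 k1 L0 e0.
(* The derivative error keeps a bounded coefficient. The error [D] of the damped values is bounded
   twice: uniformly, for use on the excess over [L], and by the Lipschitz estimate, for use below
   [L]. *)
have -> : a * (damped kappa w i * dw) - a * (damped kappa z i * dz) =
  damped kappa z i * (a * (dw - dz)) +
  (a * dw) * (damped kappa w i - damped kappa z i) by ring.
apply: le_trans (ler_normD _ _) _; apply: lerD.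
  rewrite normrM; apply: ler_pM => //; first exact: damped_bounded.
  exact: young.
rewrite normrM.
set D := `|damped kappa w i - _|.
have D1 : D <= 2 * kappa^-1.
  apply: le_trans (ler_normB _ _) _; rewrite mulrDl mul1r lerD//;
  exact: damped_bounded.
have D2 : D <= (1 + 2 * (1 + kappa^-1)) *
    \sum_k ((e + e^-1 * (w k - z k) ^+ 2) / 2).
  apply: le_trans (damped_lipschitz w z i k0 k1) _.
  rewrite ler_wpM2l//.
    by rewrite addr_ge0// mulr_ge0// addr_ge0// invr_ge0 ltW.
  apply: ler_sum => k _.
  by have := young 1 (w k - z k) e0; rewrite mul1r expr1n mulr1.
set M := Num.max _ _.
have M0 : 0 <= M by rewrite /M le_max lexx orbT.
have ML : `|a * dw| <= M + L by rewrite -lerBlDr /M le_max lexx.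
apply: (@le_trans _ _ ((M + L) * D)).
  by apply: ler_wpM2r => //; exact: normr_ge0.
rewrite mulrDl; apply: lerD; first by rewrite mulrC ler_wpM2r.
by rewrite -mulrA ler_wpM2l.
Qed.

Section flux.
Variables (m : nat) (w : 'I_m -> 'rV[R]_n -> R).
Hypothesis Hw : forall i, H10 U (w i).

Let Lw i : L2 U (w i). Proof. exact: H10_L2. Qed.

Let mw i : measurable_fun U (w i). Proof. by case: (Lw i). Qed.

Let Ldw i j : L2 U (weak_pderiv U j (w i)).
Proof. exact: H10_weak_pderiv_L2. Qed.

Let h j i x := `|v j x * weak_pderiv U j (w i) x|.

Let Ih j i : vol.-integrable U (EFin \o h j i).
Proof. by apply: integrable_norm => //; exact: L2M_integrable. Qed.

Let X j i (N : nat) := \int[vol]_(x in U) Num.max (h j i x - N%:R) 0.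

Let flux kappa := \sum_j \sum_i \int[vol]_(x in U)
  (v j x * (damped kappa (w^~ x) i * weak_pderiv U j (w i) x)).

(** Compare with test functions at distance [e], whose flux is 0. The truncated function [h j i]
    involves only [v] and [w], so its excess does not depend on [e]; with [N] fixed, every other
    error is at most [C j * e] and disappears as [e] tends to 0. *)
Let flux_le kappa (N : nat) : 0 < kappa -> kappa <= 1 ->
  `|flux kappa| <= \sum_j \sum_i 2 * kappa^-1 * X j i N.
Proof.
move=> k0 k1.
pose V := fine (vol U).
pose C j := kappa^-1 * ((\int[vol]_(x in U) (v j x ^+ 2) + 1) / 2) +
  N%:R * (1 + 2 * (1 + kappa^-1)) * \sum_(k < m) ((V + 1) / 2).
apply: (@ler_addeps _ _ (\sum_j \sum_(i < m) C j)) => e e0.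
have ei0 : 0 < e^-1 by rewrite invr_gt0.
have [Phi tPhi] := choice (fun i => H10_approx (Hw i) e0).
have t1 i : test_function U (Phi i) by case: (tPhi i).
have t2 i : \int[vol]_(x in U) ((w i x - Phi i x) ^+ 2) <= e ^+ 2.
  by case: (tPhi i).
have t3 i j : \int[vol]_(x in U)
    ((weak_pderiv U j (w i) x - pderiv j (Phi i) x) ^+ 2) <= e ^+ 2.
  by case: (tPhi i).
have LPhi i := test_function_L2 mU (t1 i).
have LdPhi i j := test_function_pderiv_L2 j mU (t1 i).
have mPhi i : measurable_fun U (Phi i) by case: (LPhi i).
have /(congr1 (fun t => flux kappa - t)) := damped_flux_test_function k0 k1 t1.
rewrite subr0 => <-; rewrite /flux -sumrB mulr_suml -big_split/=.
apply: le_trans (ler_norm_sum _ _ _) _; apply: ler_sum => j _.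
rewrite -sumrB mulr_suml -big_split/=.
apply: le_trans (ler_norm_sum _ _ _) _; apply: ler_sum => i _.
have I1 := @damped_flux_integrable m kappa w
  (fun i => weak_pderiv U j (w i)) i j k0 k1 mw (Ldw i j).
have I2 := @damped_flux_integrable m kappa Phi
  (fun i => pderiv j (Phi i)) i j k0 k1 mPhi (LdPhi i j).
rewrite -RintegralB//.
have I12 := integrableB mU I1 I2.
apply: le_trans (le_normr_Rintegral mU I12) _.
have Jv := L2_sqr_integrable (Lv j).
have Jd := L2_sqr_integrable (L2B mU (Ldw i j) (LdPhi i j)).
have Jw k := L2_sqr_integrable (L2B mU (Lw k) (LPhi k)).
have Je := L2_integrable mU Uoo (L2_cst mU e Uoo).
have JX : vol.-integrable U (EFin \o (fun x => Num.max (h j i x - N%:R) 0)).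
  have /integrableP[/measurable_EFinP mh _] := Ih j i.
  apply: dominated_integrable (Ih j i) _ => //.
    by apply: measurable_maxr => //; exact: measurable_funB.
  move=> x _; rewrite ger0_norm ?le_max ?lexx ?orbT//.
  by rewrite ge_max normr_ge0 andbT lerBlDr lerDl.
pose g1 x := kappa^-1 / 2 * e * v j x ^+ 2.
pose g2 x := kappa^-1 / 2 * e^-1 *
  (weak_pderiv U j (w i) x - pderiv j (Phi i) x) ^+ 2.
pose g3 x := 2 * kappa^-1 * Num.max (h j i x - N%:R) 0.
pose c := N%:R * (1 + 2 * (1 + kappa^-1)).
have c0 : 0 <= c.
  by rewrite mulr_ge0// addr_ge0// mulr_ge0// addr_ge0// invr_ge0 ltW.
pose g4 k x := c / 2 * e + c / 2 * e^-1 * (w k x - Phi k x) ^+ 2.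
have G1 : vol.-integrable U (EFin \o g1) by exact: (integrableZl mU _ Jv).
have G2 : vol.-integrable U (EFin \o g2) by exact: (integrableZl mU _ Jd).
have G3 : vol.-integrable U (EFin \o g3) by exact: (integrableZl mU _ JX).
have G4a k : vol.-integrable U
    (EFin \o (fun x => c / 2 * e^-1 * (w k x - Phi k x) ^+ 2)).
  exact: (integrableZl mU _ (Jw k)).
have Jc := L2_integrable mU Uoo (L2_cst mU (c / 2 * e) Uoo).
have G4 k : vol.-integrable U (EFin \o g4 k).
  exact: (integrableD mU Jc (G4a k)).
have G4s := integrable_Rsum mU (index_enum 'I_m) G4.
have G12 := integrableD mU G1 G2.
have G34 := integrableD mU G3 G4s.
have G := integrableD mU G12 G34.
apply: (@le_trans _ _ (\int[vol]_(x in U)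
    (g1 x + g2 x + (g3 x + \sum_k g4 k x)))).
  apply: le_Rintegral => //.
    exact: integrable_norm.
  move=> x _ /=.
  have := @damped_flux_error m kappa N%:R e (w^~ x) (Phi^~ x) (v j x)
    (weak_pderiv U j (w i) x) (pderiv j (Phi i) x) i k0 k1 (ler0n _ _) e0.
  move/le_trans; apply; rewrite le_eqVlt; apply/orP; left; apply/eqP.
  rewrite /g1 /g2 /g3 /g4 /h; congr (_ + (_ + _)); first by ring.
  by rewrite -/c mulr_sumr; apply: eq_bigr => k _; ring.
rewrite (RintegralD mU G12 G34) (RintegralD mU G1 G2) (RintegralD mU G3 G4s).
rewrite (Rintegral_sum mU _ G4).
rewrite (RintegralZl _ mU Jv) (RintegralZl _ mU Jd) (RintegralZl _ mU JX).
rewrite -/(X j i N) addrCA lerD2l.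
rewrite /C mulrDl; apply: lerD.
  apply: (@le_trans _ _ (kappa^-1 / 2 * e * \int[vol]_(x in U) (v j x ^+ 2) +
      kappa^-1 / 2 * e^-1 * e ^+ 2)).
    rewrite lerD2l ler_wpM2l//; apply: mulr_ge0; last exact: ltW.
    by rewrite divr_ge0// invr_ge0 ltW.
  by rewrite le_eqVlt; apply/orP; left; apply/eqP; field; rewrite !gt_eqF.
rewrite -/c mulrAC !mulr_sumr; apply: ler_sum => k _.
rewrite (RintegralD mU Jc (G4a k)) (RintegralZl _ mU (Jw k)) Rintegral_cst// -/V.
apply: (@le_trans _ _ (c / 2 * e * V + c / 2 * e^-1 * e ^+ 2)).
  rewrite lerD2l ler_wpM2l//; apply: mulr_ge0; last exact: ltW.
  exact: divr_ge0.
by rewrite le_eqVlt; apply/orP; left; apply/eqP; field; rewrite !gt_eqF.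
Qed.

(** At fixed [kappa] the bound of [flux_le] tends to 0 as the truncation height [N] grows. *)
Lemma damped_flux0 kappa : 0 < kappa -> kappa <= 1 -> \sum_j \sum_i
  \int[vol]_(x in U)
    (v j x * (damped kappa (w^~ x) i * weak_pderiv U j (w i) x)) = 0.
Proof.
move=> k0 k1; rewrite -/(flux kappa).
have cX : \sum_j \sum_i 2 * kappa^-1 * X j i N @[N --> \oo] --> (0 : R).
  rewrite [X in _ --> X](_ : _ = \sum_(j < n) \sum_(i < m) (2 * kappa^-1 * 0)).
    apply: cvg_big => [|j _]; first exact: add_continuous.
    apply: cvg_big => [|i _]; first exact: add_continuous.
    apply: cvgMl_tmp.
    apply: Rintegral_excess_cvg0 => // x _; exact: normr_ge0.
  by rewrite big1// => j _; rewrite big1// => i _; rewrite mulr0.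
apply/eqP; rewrite -normr_le0 leNgt; apply/negP => f0.
have /filter_ex[N] : \forall N \near \oo,
    \sum_j \sum_i 2 * kappa^-1 * X j i N < `|flux kappa|.
  exact: cvgr_lt cX _ f0.
by apply/negP; rewrite -leNgt; exact: flux_le.
Qed.

(* If the integrand is not integrable, its [Rintegral] is 0 anyway. This is what
   makes a Sobolev embedding dispensable. *)
Lemma convective_term0 :
  \int[vol]_(x in U) (\sum_i (\sum_j v j x * weak_pderiv U j (w i) x) * w i x) = 0.
Proof.
set P := fun x => \sum_i _.
have mP : measurable_fun U P.
  apply: measurable_sum => i; apply: measurable_funM => //.
  by apply: measurable_sum => j; apply: measurable_funM;
    [case: (Lv j)|case: (Ldw i j)].
have [iP|] := pselect (vol.-integrable U (EFin \o P)); last first.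
  exact: Rintegral_not_integrable.
pose kap (k : nat) : R := k.+1%:R^-1.
pose r k x := (1 + kap k * \sum_i w i x ^+ 2)^-1.
have kap0 k : 0 < kap k by rewrite invr_gt0.
have kap1 k : kap k <= 1 by rewrite invf_le1// ler1n.
have S0 x : 0 <= \sum_i w i x ^+ 2 by apply: sumr_ge0 => i _; exact: sqr_ge0.
have r01 k x : 0 <= r k x <= 1.
  have := mulr_ge0 (ltW (kap0 k)) (S0 x) => kS.
  by rewrite invr_ge0 addr_ge0//= invf_le1 ?lerDl// ltr_wpDr.
have mr k : measurable_fun U (r k) by exact: measurable_damping.
(* $G_\kappa$ depends on [w] only through its length, so the damping is a scalar factor common to
   all components: the damped flux is the integral of [r k x ^+ 2 * P x], dominated by [|P|]. *)
pose f_ k x := (r k x ^+ 2 * P x)%:E.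
have f0 k : (\int[vol]_(x in U) f_ k x = 0)%E.
  have If : vol.-integrable U (f_ k).
    apply: (@dominated_integrable _ _ _ _ _ mU _ (fun x => `|P x|)).
    - by apply: measurable_funM => //; exact: measurable_funX.
    - exact: integrable_norm.
    - move=> x _; rewrite normrM ger0_norm ?sqr_ge0// ler_piMl//.
      by have /andP[? ?] := r01 k x; rewrite exprn_ile1.
  rewrite -[LHS]fineK; last exact: integrable_fin_num.
  congr EFin; rewrite -(damped_flux0 (kap0 k) (kap1 k)).
  have Iw i j := @damped_flux_integrable m (kap k) w
    (fun i => weak_pderiv U j (w i)) i j (kap0 k) (kap1 k) mw (Ldw i j).
  under [RHS]eq_bigr => j _ do rewrite -(Rintegral_sum mU _ (Iw ^~ j)).
  rewrite -Rintegral_sum//; last by move=> j; apply: integrable_Rsum.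
  apply: eq_Rintegral => x _; rewrite /P exchange_big mulr_sumr.
  apply: eq_bigr => i _; rewrite mulr_suml mulr_sumr.
  by apply: eq_bigr => j _; rewrite /damped -/(r k x); ring.
have mf k : measurable_fun U (f_ k).
  by apply/measurable_EFinP; apply: measurable_funM => //; exact: measurable_funX.
have cf : {ae vol, forall x, U x -> f_ ^~ x @ \oo --> (EFin \o P) x}.
  apply: aeW => x _; apply: cvg_EFin; first by apply: nearW.
  rewrite [X in _ --> X](_ : _ = (1 + 0 * \sum_i w i x ^+ 2)^-1 *
      (1 + 0 * \sum_i w i x ^+ 2)^-1 * P x).
    rewrite (_ : fine \o _ = fun k => r k x * r k x * P x)//.
    apply: cvgMr_tmp.
    have cr : r ^~ x @ \oo --> (1 + 0 * \sum_i w i x ^+ 2)^-1.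
      apply: cvgV; first by rewrite mul0r addr0 oner_neq0.
      apply: cvgD; first exact: cvg_cst.
      by apply: cvgMr_tmp; exact: cvg_harmonic.
    exact: cvgM.
  by rewrite mul0r addr0 invr1 !mul1r.
have fP : {ae vol, forall x k, U x ->
    (`|f_ k x| <= (EFin \o (fun x => `|P x|)%R) x)%E}.
  apply: aeW => x k _ /=; rewrite lee_fin normrM ger0_norm ?sqr_ge0// ler_piMl//.
  by have /andP[? ?] := r01 k x; rewrite exprn_ile1.
have mEP : measurable_fun U (EFin \o P) by exact/measurable_EFinP.
have [_ _] := @dominated_convergence _ _ _ vol U mU f_ (EFin \o P)
  (EFin \o (fun x => `|P x|)) mf mEP cf (integrable_norm iP) fP.
rewrite (_ : (fun k => _) = cst 0%E); last by apply/funext => k; rewrite f0.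
move=> c0; rewrite /Rintegral.
by have /cvg_lim <- // := c0; rewrite lim_cst.
Qed.

End flux.
End skew_symmetry.

(** * The energy estimate *)

Section pointwise.
Context {R : realType}.

Lemma dotmx_ge0 m n (A : 'M[R]_(m, n)) : 0 <= dotmx A A.
Proof.
by apply: sumr_ge0 => i _; apply: sumr_ge0 => j _; rewrite -expr2 sqr_ge0.
Qed.

Lemma dotmxZ m n (c : R) (A B : 'M[R]_(m, n)) : dotmx (c *: A) B = c * dotmx A B.
Proof.
rewrite /dotmx mulr_sumr; apply: eq_bigr => i _.
by rewrite mulr_sumr; apply: eq_bigr => j _; rewrite mxE mulrA.
Qed.

Lemma dotmxC m n (A B : 'M[R]_(m, n)) : dotmx A B = dotmx B A.
Proof. by apply: eq_bigr => i _; apply: eq_bigr => j _; rewrite mulrC. Qed.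

Lemma dotmxDr m n (A B C : 'M[R]_(m, n)) : dotmx A (B + C) = dotmx A B + dotmx A C.
Proof.
rewrite /dotmx -big_split; apply: eq_bigr => i _ /=.
by rewrite -big_split; apply: eq_bigr => j _; rewrite mxE mulrDr.
Qed.

Lemma dotmxDl m n (A B C : 'M[R]_(m, n)) : dotmx (A + B) C = dotmx A C + dotmx B C.
Proof. by rewrite dotmxC dotmxDr !(dotmxC C). Qed.

Lemma dotmxNl m n (A B : 'M[R]_(m, n)) : dotmx (- A) B = - dotmx A B.
Proof. by rewrite -scaleN1r dotmxZ mulN1r. Qed.

Lemma enorm_sqr m n (A : 'M[R]_(m, n)) : enorm A ^+ 2 = dotmx A A.
Proof. by rewrite sqr_sqrtr// dotmx_ge0. Qed.

Lemma dotmx_young m n (A B : 'M[R]_(m, n)) (c : R) : 0 < c ->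
  2 * dotmx A B <= c * dotmx A A + c^-1 * dotmx B B.
Proof.
move=> c0; rewrite /dotmx !mulr_sumr -big_split; apply: ler_sum => i _ /=.
rewrite !mulr_sumr -big_split; apply: ler_sum => j _ /=.
have /ler_normlP[_] := young (A i j) (B i j) c0.
by rewrite -!expr2; lra.
Qed.

(* Young's inequality in the pairing of [A] with the outer product of [g] and
   [z], whose squared length is [|g|^2 |z|^2]. *)
Lemma dotmx_mulmx_young n (g z : 'rV[R]_n) (A : 'M[R]_n) (c k : R) :
  0 < c -> dotmx g g <= k ->
  2 * dotmx (g *m A) z <= c * dotmx A A + c^-1 * (k * dotmx z z).
Proof.
move=> c0 gk.
have -> : dotmx (g *m A) z = dotmx A (g^T *m z).
  rewrite /dotmx big_ord1.
  under eq_bigr do rewrite mxE mulr_suml.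
  rewrite exchange_big; apply: eq_bigr => i _; apply: eq_bigr => j _.
  by rewrite mxE big_ord1 mxE; ring.
apply: le_trans (dotmx_young _ _ c0) _; rewrite lerD2l ler_wpM2l//.
  by rewrite invr_ge0 ltW.
have -> : dotmx (g^T *m z) (g^T *m z) = dotmx g g * dotmx z z.
  rewrite /dotmx !big_ord1 mulr_suml; apply: eq_bigr => i _.
  rewrite mulr_sumr; apply: eq_bigr => j _.
  by rewrite !mxE !big_ord1 !mxE; ring.
by rewrite ler_wpM2r// dotmx_ge0.
Qed.

(** The weight $c = 2k$ leaves exactly one half on [z]. It degenerates when $k = 0$, but then $g =
    0$. *)
Lemma dotmx_mulmx_young_half n (g z : 'rV[R]_n) (A : 'M[R]_n) (k : R) :
  dotmx g g <= k ->
  2 * dotmx (g *m A) z <= 2 * k * dotmx A A + 2^-1 * dotmx z z.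
Proof.
move=> gk; have : 0 <= k by apply: le_trans gk; exact: dotmx_ge0.
rewrite le_eqVlt => /orP[/eqP k0|k0]; last first.
  have := @dotmx_mulmx_young n g z A (2 * k) k (mulr_gt0 (ltr0Sn _ 1) k0) gk.
  by rewrite mulrA invfM mulfVK ?gt_eqF.
have g0 i : g ord0 i = 0.
  have : dotmx g g == 0 by rewrite eq_le dotmx_ge0 andbT k0.
  rewrite /dotmx big_ord1 psumr_eq0; last by move=> j _; rewrite -expr2 sqr_ge0.
  by move=> /allP/(_ i (mem_index_enum _))/=; rewrite mulf_eq0 orbb => /eqP.
rewrite -k0 mulr0 mul0r add0r (_ : g = 0); last by apply/rowP => i; rewrite g0 mxE.
rewrite mul0mx -(scale0r (0 : 'rV[R]_n)) dotmxZ mul0r mulr0.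
by rewrite mulr_ge0// ?dotmx_ge0// invr_ge0.
Qed.

End pointwise.

Section L2_matrix_fields.
Context {R : realType} {n : nat} (U : set 'rV[R]_n).
Hypothesis mU : measurable U.

Lemma measurable_dotmx p r (F G : 'rV[R]_n -> 'M[R]_(p, r)) :
  (forall i j, measurable_fun U (fun x => F x i j)) ->
  (forall i j, measurable_fun U (fun x => G x i j)) ->
  measurable_fun U (fun x => dotmx (F x) (G x)).
Proof.
move=> mF mG; apply: measurable_sum => i; apply: measurable_sum => j.
exact: measurable_funM.
Qed.

Lemma integrable_dotmx p r (F G : 'rV[R]_n -> 'M[R]_(p, r)) :
  (forall i j, L2 U (fun x => F x i j)) ->
  (forall i j, L2 U (fun x => G x i j)) ->
  vol.-integrable U (EFin \o (fun x => dotmx (F x) (G x))).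
Proof.
move=> LF LG; apply: integrable_Rsum => // i; apply: integrable_Rsum => // j.
exact: L2M_integrable.
Qed.

Lemma L2_vec_entry p (w : 'rV[R]_n -> 'rV[R]_p) i j :
  L2_vec U w -> L2 U (fun x => w x i j).
Proof. by rewrite (ord1 i); exact. Qed.

Lemma L2_vec_integrable_dotmx p (v w : 'rV[R]_n -> 'rV[R]_p) :
  L2_vec U v -> L2_vec U w ->
  vol.-integrable U (EFin \o (fun x => dotmx (v x) (w x))).
Proof. by move=> Lv Lw; apply: integrable_dotmx => i j; exact: L2_vec_entry. Qed.

Lemma H10_vec_L2 (w : 'rV[R]_n -> 'rV[R]_n) : H10_vec U w -> L2_vec U w.
Proof. by move=> Hw i; exact: H10_L2. Qed.

Lemma H10_vgrad_L2 (w : 'rV[R]_n -> 'rV[R]_n) i j :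
  H10_vec U w -> L2 U (fun x => vgrad U w x i j).
Proof.
move=> Hw; rewrite (_ : (fun x => _) = weak_pderiv U j (component w i)).
  exact: H10_weak_pderiv_L2.
by apply/funext => x; rewrite mxE.
Qed.

Lemma ip_ge0 p r (F : 'rV[R]_n -> 'M[R]_(p, r)) : 0 <= ip U F F.
Proof. by apply: Rintegral_ge0 => x _; exact: dotmx_ge0. Qed.

Lemma L2norm_sqr p r (F : 'rV[R]_n -> 'M[R]_(p, r)) : L2norm U F ^+ 2 = ip U F F.
Proof. by rewrite sqr_sqrtr// ip_ge0. Qed.

End L2_matrix_fields.

(** * One time step, with [u0], [u1], [A] standing for $u_n$, $u_{n+1}$, $\nabla u_n$ *)

Section energy.
Context {R : realType} {n : nat} (U : set 'rV[R]_n).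
Hypothesis mU : measurable U.
Variables (u0 u1 F g : 'rV[R]_n -> 'rV[R]_n) (A : 'rV[R]_n -> 'M[R]_n).
Variables (tau nu_min K eta : R).
Hypothesis tau0 : 0 < tau.
Hypothesis nu_min0 : 0 < nu_min.
Hypothesis eta0 : 0 < eta.
Hypothesis Lu0 : L2_vec U u0.
Hypothesis Lu1 : L2_vec U u1.
Hypothesis LF : L2_vec U F.
Hypothesis LA : forall i j, L2 U (fun x => A x i j).
Hypothesis mg : forall j, measurable_fun U (fun x => g x ord0 j).
Hypothesis gK : {ae vol, forall x, U x -> enorm (g x) <= K}.

Let du x := u1 x - u0 x.

Let Ldu : L2_vec U du.
Proof.
move=> i; rewrite (_ : component du i =
    fun x => component u1 i x - component u0 i x).
  exact: L2B.
by apply/funext => x; rewrite /component !mxE.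
Qed.

Let I00 := L2_vec_integrable_dotmx mU Lu0 Lu0.
Let I11 := L2_vec_integrable_dotmx mU Lu1 Lu1.
Let Idd := L2_vec_integrable_dotmx mU Ldu Ldu.
Let Id1 := L2_vec_integrable_dotmx mU Ldu Lu1.
Let IFF := L2_vec_integrable_dotmx mU LF LF.
Let IF1 := L2_vec_integrable_dotmx mU LF Lu1.
Let IAA := integrable_dotmx mU LA LA.

Let gK2 : {ae vol, forall x, U x -> dotmx (g x) (g x) <= K ^+ 2}.
Proof.
apply: filterS gK => x gx /gx {}gx; rewrite -enorm_sqr lerXn2r// nnegrE.
  exact: sqrtr_ge0.
by apply: le_trans gx; exact: sqrtr_ge0.
Qed.

Let IG1 : vol.-integrable U (EFin \o (fun x => dotmx (g x *m A x) (u1 x))).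
Proof.
pose b x := dotmx (A x) (A x) + K ^+ 2 * dotmx (u1 x) (u1 x).
apply: (@ae_dominated_integrable _ _ _ _ _ mU _ b).
- apply: measurable_dotmx => i j; last by case: (L2_vec_entry i j Lu1).
  rewrite (_ : (fun x => _) = fun x => \sum_k g x ord0 k * A x k j).
    apply: measurable_sum => k; apply: measurable_funM => //.
    by case: (LA k j).
  by apply/funext => x; rewrite (ord1 i) mxE.
- exact: (integrableD mU IAA (integrableZl mU _ I11)).
- apply: filterS gK2 => x gx /gx {}gx.
  have b0 : 0 <= b x.
    by rewrite addr_ge0 ?dotmx_ge0// mulr_ge0 ?dotmx_ge0// sqr_ge0.
  have := @dotmx_mulmx_young _ _ (g x) (u1 x) (A x) 1 _ ltr01 gx.
  have := @dotmx_mulmx_young _ _ (- g x) (u1 x) (A x) 1 (K ^+ 2) ltr01.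
  rewrite mulNmx !dotmxNl dotmxC dotmxNl opprK => /(_ gx).
  rewrite invr1 !mul1r -/(b x) => h1 h2.
  by rewrite ler_norml; apply/andP; split; lra.
Qed.

(** The identity $2(b-a)\cdot b = |b|^2 - |a|^2 + |b-a|^2$; its last term is the reserve from which
    the remainders in [du] are paid. *)
Let time_difference : 2 * ip U du u1 = ip U u1 u1 - ip U u0 u0 + ip U du du.
Proof.
rewrite -(RintegralZl _ mU Id1) -(RintegralB mU I11 I00).
rewrite -(RintegralD mU (integrableB mU I11 I00) Idd).
apply: eq_Rintegral => x _; rewrite /du !(dotmxDl, dotmxDr, dotmxNl).
rewrite !(dotmxC _ (- u0 x)) !(dotmxDl, dotmxDr, dotmxNl) (dotmxC (u0 x) (u1 x)).
ring.
Qed.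

(** Split [u1 = u0 + du]. The part in [u0] takes Young's weight [nu_min]; in the part in [du], [tau]
    is moved into [g], whose squared length is then at most $\tau^2K^2$, leaving one half of
    $|du|^2$. *)
Let viscosity_gradient_le :
  2 * tau * ip U (fun x => g x *m A x) u1 <=
  (tau * nu_min + 2 * tau ^+ 2 * K ^+ 2) * ip U A A +
  tau * K ^+ 2 / nu_min * ip U u0 u0 + 2^-1 * ip U du du.
Proof.
rewrite -(RintegralZl _ mU IG1) -(RintegralZl _ mU IAA) -(RintegralZl _ mU I00).
rewrite -(RintegralZl _ mU Idd).
have JA := integrableZl mU (tau * nu_min + 2 * tau ^+ 2 * K ^+ 2) IAA.
have J0 := integrableZl mU (tau * K ^+ 2 / nu_min) I00.
have Jd := integrableZl mU (2^-1) Idd.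
rewrite -(RintegralD mU JA J0) -(RintegralD mU (integrableD mU JA J0) Jd).
apply: ae_le_Rintegral => //.
- exact: (integrableZl mU _ IG1).
- exact: (integrableD mU (integrableD mU JA J0) Jd).
- apply: filterS gK2 => x gx /gx {}gx.
  rewrite {1}(_ : u1 x = u0 x + du x); last by rewrite /du addrC subrK.
  rewrite dotmxDr.
  have c0 : 0 < nu_min by [].
  have h1 := @dotmx_mulmx_young _ _ (g x) (u0 x) (A x) nu_min _ c0 gx.
  have gx' : dotmx (tau *: g x) (tau *: g x) <= tau ^+ 2 * K ^+ 2.
    rewrite dotmxZ dotmxC dotmxZ mulrA -expr2.
    by rewrite ler_wpM2l// sqr_ge0.
  have := @dotmx_mulmx_young_half _ _ (tau *: g x) (du x) (A x) _ gx'.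
  rewrite -scalemxAl dotmxZ => h2.
  have := ler_wpM2l (ltW tau0) h1; lra.
Qed.

(** The same splitting, with weight [eta] against [u0] and weight [2 * tau] against [du]. The latter
    leaves the second half of $|du|^2$, and the two weights add up to the factor [2 * tau + eta]. *)
Let forcing_le :
  2 * tau * ip U F u1 <=
  (2 * tau + eta) * (tau * ip U F F) +
  tau / eta * ip U u0 u0 + 2^-1 * ip U du du.
Proof.
rewrite -(RintegralZl _ mU IF1) mulrA -(RintegralZl _ mU IFF).
rewrite -(RintegralZl _ mU I00) -(RintegralZl _ mU Idd).
have JF := integrableZl mU ((2 * tau + eta) * tau) IFF.
have J0 := integrableZl mU (tau / eta) I00.
have Jd := integrableZl mU (2^-1) Idd.
rewrite -(RintegralD mU JF J0) -(RintegralD mU (integrableD mU JF J0) Jd).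
apply: le_Rintegral => //.
- exact: (integrableZl mU _ IF1).
- exact: (integrableD mU (integrableD mU JF J0) Jd).
- move=> x _; rewrite {1}(_ : u1 x = u0 x + du x); last by rewrite /du addrC subrK.
  rewrite dotmxDr.
  have h1 := dotmx_young (F x) (u0 x) eta0.
  have h2 := dotmx_young (F x) (du x) (mulr_gt0 (ltr0Sn R 1) tau0).
  have := ler_wpM2l (ltW tau0) h1; have := ler_wpM2l (ltW tau0) h2.
  rewrite (_ : tau * (_ + (2 * tau)^-1 * _) =
      2 * tau ^+ 2 * dotmx (F x) (F x) + 2^-1 * dotmx (du x) (du x)).
    lra.
  by field; rewrite gt_eqF.
Qed.

Lemma energy_step (D : R) :
  tau^-1 * ip U du u1 + D = ip U (fun x => g x *m A x) u1 + ip U F u1 ->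
  ip U u1 u1 + 2 * tau * D <=
  (1 + tau / eta + tau * K ^+ 2 / nu_min) * ip U u0 u0 +
  tau * nu_min * (1 + 2 * tau * K ^+ 2 / nu_min) * ip U A A +
  (2 * tau + eta) * (tau * ip U F F).
Proof.
move=> /(congr1 (fun t => 2 * tau * t)).
rewrite (_ : 2 * tau * (_ + D) = 2 * ip U du u1 + 2 * tau * D); last first.
  by field; rewrite gt_eqF.
rewrite time_difference.
move: viscosity_gradient_le forcing_le.
rewrite (_ : tau * nu_min * (1 + _) =
    tau * nu_min + 2 * tau ^+ 2 * K ^+ 2); last first.
  by field; rewrite gt_eqF.
lra.
Qed.

End energy.

(** * Discrete Gronwall inequality and the stability estimate *)

(** Of the two copies of [D n.+1] gained in a step, one is carried to the right-hand side of the
    next step and the other joins the sum. Nonnegativity of [F] lets each new term enter under the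
    common power of [1 + gam]. *)
Lemma discrete_gronwall (R : realType) (a D F : nat -> R) (gam : R) (N : nat) :
  0 <= gam -> (forall n, 0 <= D n) -> (forall n, 0 <= F n) ->
  (forall n, (n < N)%N ->
     a n.+1 + 2 * D n.+1 <= (1 + gam) * (a n + D n) + F n.+1) ->
  a N + D N + \sum_(1 <= n < N.+1) D n <=
  (1 + gam) ^+ N * (a 0%N + D 0%N + \sum_(1 <= n < N.+1) F n).
Proof.
move=> g0 D0 F0 step.
suff S n : (n <= N)%N -> a n + D n + \sum_(1 <= k < n.+1) D k <=
  (1 + gam) ^+ n * (a 0%N + D 0%N + \sum_(1 <= k < n.+1) F k) by exact: S.
elim: n => [|n IHn] nN; first by rewrite !big_geq// expr0 mul1r !addr0.
rewrite big_nat_recr//= [\sum_(1 <= k < n.+2) F k]big_nat_recr//=.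
have := IHn (ltnW nN); have := step n nN.
set SD := \sum_(1 <= k < n.+1) D k; set SF := \sum_(1 <= k < n.+1) F k.
have SD0 : 0 <= SD by apply: sumr_ge0 => k _.
have g1 : 1 <= (1 + gam) ^+ n by rewrite exprn_ege1// lerDl.
have Fn : F n.+1 <= (1 + gam) * ((1 + gam) ^+ n * F n.+1).
  by have := F0 n.+1 => ?; rewrite mulrA ler_peMl// -exprS exprn_ege1// lerDl.
rewrite exprS => h1 h2.
have : (1 + gam) * (a n + D n + SD) <=
    (1 + gam) * ((1 + gam) ^+ n * (a 0%N + D 0%N + SF)).
  by rewrite ler_wpM2l// addr_ge0.
have : 0 <= gam * SD by rewrite mulr_ge0.
rewrite -mulrA [in X in _ -> _ -> _ <= X]addrA !mulrDr.
lra.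
Qed.

Theorem theorem3p3 (R : realType) (d : nat) (Omega : set 'rV[R]_d)
    (T : R) (N : nat) (nu : 'rV[R]_d -> R -> R) (nu_min : R)
    (f : 'rV[R]_d -> R -> 'rV[R]_d)
    (u : nat -> 'rV[R]_d -> 'rV[R]_d) (p : nat -> 'rV[R]_d -> R) (eps : R) :
  let tau : R := T / N%:R in
  let nu_ (n : nat) (x : 'rV[R]_d) : R := nu x (n%:R * tau) in
  let f_ (n : nat) (x : 'rV[R]_d) : 'rV[R]_d := f x (n%:R * tau) in
  let K : R := fine (Linf_norm Omega T (st_grad Omega T nu)) in
  let M : R := expR (eps + 2 * T * K ^+ 2 / nu_min) in
  let C0 : R :=
    (1 + eps * tau / T + 2 * K ^+ 2 * tau / nu_min) *
    (L2norm Omega (u 0%N) ^+ 2 +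
     tau * nu_min * L2norm Omega (vgrad Omega (u 0%N)) ^+ 2) in
  (d = 2%N \/ d = 3%N) ->
  bounded_lipschitz_domain Omega ->
  0 < T ->
  (2 <= N)%N ->
  0 < nu_min ->
  (forall x t, closure Omega x -> 0 <= t <= T -> nu_min <= nu x t) ->
  Linf_grad Omega T nu ->
  (forall n : nat, (n <= N)%N ->
     (forall j, weakly_derivable Omega j (nu_ n)) /\
     {ae vol, forall x, Omega x -> enorm (grad Omega (nu_ n) x) <= K}) ->
  L2_vec (cylinder Omega `]0, T]) (uncurry_st f) ->
  (forall n : nat, (1 <= n <= N)%N -> L2_vec Omega (f_ n)) ->
  H10_vec Omega (u 0%N) ->
  {ae vol, forall x, Omega x -> divergence Omega (u 0%N) x = 0} ->
  (forall n : nat, (n < N)%N ->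
     H10_vec Omega (u n.+1) /\ L20 Omega (p n.+1)) ->
  (forall (n : nat) (w : 'rV[R]_d -> 'rV[R]_d), (n < N)%N -> H10_vec Omega w ->
     vol.-integrable Omega (fun x =>
       (dotmx (nu_ n x *: vgrad Omega (u n.+1) x) (vgrad Omega w x))%:E)) ->
  (forall n : nat, (n < N)%N ->
     vol.-integrable Omega (fun x =>
       (enorm (Num.sqrt (nu_ n x) *: vgrad Omega (u n.+1) x) ^+ 2)%:E)) ->
  (forall (n : nat) (w : 'rV[R]_d -> 'rV[R]_d) (q : 'rV[R]_d -> R),
     (n < N)%N -> H10_vec Omega w -> L20 Omega q ->
     tau^-1 * ip Omega (fun x => u n.+1 x - u n x) w
     + ip Omega (fun x => nu_ n x *: vgrad Omega (u n.+1) x) (vgrad Omega w)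
     + ip Omega (fun x => u n x *m (vgrad Omega (u n.+1) x)^T) w
     - \int[vol]_(x in Omega) (p n.+1 x * divergence Omega w x)
     = ip Omega (fun x => grad Omega (nu_ n) x *m ((vgrad Omega (u n) x)^T)^T) w
       + ip Omega (f_ n.+1) w
     /\ \int[vol]_(x in Omega) (q x * divergence Omega (u n.+1) x) = 0) ->
  0 < eps ->
  L2norm Omega (u N) ^+ 2
  + \sum_(1 <= n < N.+1)
      tau * L2norm Omega (fun x =>
        Num.sqrt (nu_ n.-1 x) *: vgrad Omega (u n) x) ^+ 2
  <= M * (C0 + (2 * tau + T / eps) *
           \sum_(1 <= n < N.+1) tau * L2norm Omega (f_ n) ^+ 2).
Proof.
move=> tau nu_ f_ K M C0 _ [Un0 oU _ bU _] T0 N2 nu_min0 nu_ge _ nu_grad _ Lf.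
move=> Hu0 div0 Hup nu_int D_int scheme eps0.
have mU := open_rV_measurable oU.
have Uoo := bounded_vol_lty mU bU.
have N0 : 0 < N%:R :> R by rewrite ltr0n (leq_trans _ N2).
have tau0 : 0 < tau by rewrite divr_gt0.
have tauN : N%:R * tau = T by rewrite mulrC divfK// gt_eqF.
have Hu n : (n <= N)%N -> H10_vec Omega (u n).
  by case: n => [_|n nN]; [exact: Hu0|exact: (Hup n nN).1].
have div_u n : (n <= N)%N ->
    {ae vol, forall x, Omega x -> divergence Omega (u n) x = 0}.
  case: n => [_|n nN]; first exact: div0.
  apply: (divergence_free_ae mU Uoo (Hu _ nN)) => q Lq.
  exact: (scheme n (u n.+1) q nN (Hu _ nN) Lq).2.
have nu_pos n x : (n <= N)%N -> Omega x -> nu_min <= nu_ n x.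
  move=> nN Ox; apply: nu_ge; first exact: subset_closure.
  by rewrite mulr_ge0 ?(ltW tau0)//= -tauN ler_wpM2r ?(ltW tau0)// ler_nat.
pose a n := ip Omega (u n) (u n).
pose G n := ip Omega (vgrad Omega (u n)) (vgrad Omega (u n)).
pose D n := L2norm Omega (fun x =>
  Num.sqrt (nu_ n.-1 x) *: vgrad Omega (u n) x) ^+ 2.
(* Index 0 is redefined to match [C0]: a step uses only [nu_min * G n], which for [n > 0] is at most
   [D n] and for [n = 0] is taken as it stands. *)
pose E n := if n is 0%N then nu_min * G 0%N else D n.
pose phi n := L2norm Omega (f_ n) ^+ 2.
have IG n : (n <= N)%N -> vol.-integrable Omega
    (EFin \o (fun x => dotmx (vgrad Omega (u n) x) (vgrad Omega (u n) x))).
  move=> nN; have LG i j := H10_vgrad_L2 i j (Hu _ nN).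
  exact: (integrable_dotmx mU LG LG).
have G_le n : (n <= N)%N -> nu_min * G n <= E n.
  case: n => [//|n] nN; rewrite /E /D L2norm_sqr /G /ip.
  rewrite -(RintegralZl _ mU (IG _ nN)).
  apply: (le_Rintegral mU).
  - exact: (integrableZl mU _ (IG _ nN)).
  - rewrite (_ : _ \o _ = fun x =>
      (enorm (Num.sqrt (nu_ n x) *: vgrad Omega (u n.+1) x) ^+ 2)%:E).
      exact: D_int.
    by apply/funext => x /=; rewrite enorm_sqr.
  - move=> x Ox /=; rewrite dotmxZ dotmxC dotmxZ mulrA -expr2 sqr_sqrtr.
      by rewrite ler_wpM2r ?dotmx_ge0// nu_pos// ltnW.
    by rewrite (le_trans (ltW nu_min0))// nu_pos// ltnW.
have step n : (n < N)%N ->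
    a n.+1 + 2 * tau * D n.+1 <=
    (1 + tau / (T / eps) + tau * K ^+ 2 / nu_min) * a n +
    tau * nu_min * (1 + 2 * tau * K ^+ 2 / nu_min) * G n +
    (2 * tau + T / eps) * (tau * phi n.+1).
  move=> nN; have nN' := ltnW nN.
  have [wd_nu gK] := nu_grad n nN'.
  rewrite /phi L2norm_sqr.
  apply: (@energy_step R d Omega mU (u n) (u n.+1) (f_ n.+1)
    (grad Omega (nu_ n)) (vgrad Omega (u n)) tau nu_min K (T / eps) tau0 nu_min0).
  - exact: divr_gt0.
  - by apply: H10_vec_L2; exact: Hu.
  - by apply: H10_vec_L2; exact: Hu.
  - exact: Lf.
  - by move=> i j; apply: H10_vgrad_L2; exact: Hu.
  - move=> j; rewrite (_ : (fun x => _) = weak_pderiv Omega j (nu_ n)).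
      exact: weak_pderiv_measurable.
    by apply/funext => x; rewrite mxE.
  - exact: gK.
  have [_ Lp] := Hup n nN.
  (* The pressure [p n.+1] is itself taken as [q] in the continuity equation, which removes the
     pressure term. *)
  have [+ p_div] := scheme n (u n.+1) (p n.+1) nN (Hu _ nN) Lp.
  rewrite p_div subr0.
  rewrite [X in _ + _ + X](_ : _ = 0); last first.
    have div_sum : {ae vol, forall x, Omega x ->
        \sum_j weak_pderiv Omega j (component (u n) j) x = 0}.
      by apply: filterS (div_u _ nN') => x h /h; rewrite divergence_trace.
    rewrite -[RHS](@convective_term0 R d Omega mU Uoo (component (u n)) (Hu _ nN')
      div_sum d (component (u n.+1)) (Hu _ nN)).
    apply: eq_Rintegral => x _; rewrite /dotmx big_ord1; apply: eq_bigr => i _.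
    rewrite mxE; congr (_ * _); apply: eq_bigr => j _; by rewrite !mxE.
  rewrite addr0.
  rewrite [X in _ + X = _](_ : _ = D n.+1); last first.
    rewrite /D L2norm_sqr; apply: eq_Rintegral => x; rewrite inE => Ox.
    rewrite !dotmxZ [in RHS]dotmxC dotmxZ mulrA -expr2 sqr_sqrtr//.
    by rewrite (le_trans (ltW nu_min0))// nu_pos.
  under [X in _ = X + _ -> _]eq_Rintegral do rewrite trmxK.
  by [].
pose gam := eps * tau / T + 2 * K ^+ 2 * tau / nu_min.
have gam1 : 0 <= eps * tau / T.
  by apply: divr_ge0; [apply: mulr_ge0; exact: ltW|exact: ltW].
have gam2 : 0 <= 2 * K ^+ 2 * tau / nu_min.
  apply: divr_ge0; last exact: ltW.
  by apply: mulr_ge0; [rewrite mulr_ge0 ?sqr_ge0|exact: ltW].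
have gam0 : 0 <= gam by exact: addr_ge0.
have E0 n : 0 <= E n.
  case: n => [|n]; last exact: sqr_ge0.
  by apply: mulr_ge0; [exact: ltW|exact: ip_ge0].
have tE0 n : 0 <= tau * E n by apply: mulr_ge0; [exact: ltW|exact: E0].
have phi0 n : 0 <= tau * phi n by apply: mulr_ge0; [exact: ltW|exact: sqr_ge0].
have c0 : 0 <= 2 * tau + T / eps.
  by apply: addr_ge0; [apply: mulr_ge0 => //|apply: divr_ge0]; exact: ltW.
(* With [eta = T / eps] the forcing contributes [eps * tau / T]. The coefficient of [a n] contains
   the viscosity-gradient constant once and that of [G n] contains it twice; [1 + gam] dominates
   both, whence the factor 2 in [gam]. *)
have gronwall_step n : (n < N)%N -> a n.+1 + 2 * (tau * E n.+1) <=
    (1 + gam) * (a n + tau * E n) + (2 * tau + T / eps) * (tau * phi n.+1).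
  move=> nN; rewrite mulrA; apply: le_trans (step n nN) _.
  rewrite lerD2r (mulrDr (1 + gam)); apply: lerD.
    apply: ler_wpM2r; first exact: ip_ge0.
    have -> : tau / (T / eps) = eps * tau / T by field; rewrite !gt_eqF.
    rewrite /gam; move: gam2; lra.
  rewrite (_ : tau * nu_min * _ * _ =
      (1 + 2 * tau * K ^+ 2 / nu_min) * (tau * (nu_min * G n))); last by ring.
  apply: ler_pM.
  - by move: gam2; lra.
  - apply: mulr_ge0; first exact: ltW.
    by apply: mulr_ge0; [exact: ltW|exact: ip_ge0].
  - by rewrite /gam; move: gam1; lra.
  - by apply: ler_wpM2l; [exact: ltW|exact: G_le (ltnW nN)].
have := @discrete_gronwall R a (fun n => tau * E n)
  (fun n => (2 * tau + T / eps) * (tau * phi n)) gam N gam0 tE0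
  (fun n => mulr_ge0 c0 (phi0 n)) gronwall_step.
(* [E] and [D] can differ only at index 0, outside the sum. *)
have -> : \sum_(1 <= n < N.+1) tau * E n = \sum_(1 <= n < N.+1) tau * D n.
  by apply: eq_big_nat => -[|n].
have -> : \sum_(1 <= n < N.+1) (2 * tau + T / eps) * (tau * phi n) =
    (2 * tau + T / eps) * \sum_(1 <= n < N.+1) tau * phi n by rewrite mulr_sumr.
move=> gronwall.
apply: (@le_trans _ _ (a N + tau * E N + \sum_(1 <= n < N.+1) tau * D n)).
  apply: lerD; [by rewrite L2norm_sqr lerDl|exact: lexx].
apply: le_trans gronwall _.
(* From $1 + x \le e^x$; since $N\tau = T$, the exponent $N\,$[gam] is exactly that of [M]. *)
have gM : (1 + gam) ^+ N <= M.
  have -> : M = expR gam ^+ N.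
    rewrite -expRM_natl; congr expR; rewrite /gam -tauN -mulr_natl.
    by field; rewrite !gt_eqF.
  by apply: lerXn2r; rewrite ?nnegrE ?expR_ge0 ?expR_ge1Dx// addr_ge0.
have S0 : 0 <= (2 * tau + T / eps) * \sum_(1 <= n < N.+1) tau * phi n.
  by apply: mulr_ge0 => //; apply: sumr_ge0 => n _; exact: phi0.
have B0 : 0 <= a 0%N + tau * E 0%N by apply: addr_ge0; [exact: ip_ge0|exact: tE0].
apply: ler_pM => //.
- by apply: exprn_ge0; apply: addr_ge0.
- exact: addr_ge0.
(* [C0] is [1 + gam] times the initial quantity [a 0 + tau * E 0], hence bounds it. *)
- rewrite lerD2r /C0 !L2norm_sqr -addrA -/gam -(mulrA tau) -/(G 0%N).
  rewrite -[leLHS]/(a 0%N + tau * E 0%N); apply: ler_peMl => //.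
  by rewrite lerDl.
Qed.
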